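(* For every left bisection $\sigma$ of a left Hopf algebroid $\mathcal L$ over $B$, there is an associated left Hopf algebroid automorphism $(\mathrm{Ad}^L_\sigma:\mathcal L\to\mathcal L,\ \mathrm{ad}^L_\sigma:B\to B)$ defined by $$\mathrm{Ad}^L_\sigma(X)=s(\sigma(X_{(1)}))\,X_{(2)+}\,t(\sigma(X_{(2)-})),\qquad \mathrm{ad}^L_\sigma=\sigma\circ s .$$ Moreover, an automorphism $(\Phi,\phi)$ of $\mathcal L$ acts on a left bisection $\sigma$ by $$(\Phi,\phi)\triangleright\sigma=\phi\circ\sigma\circ\Phi^{-1}.$$ The map $\mathrm{Ad}^L:\mathcal B(\mathcal L)\to\mathrm{Aut}(\mathcal L)$ and the action $\triangleright$ of $\mathrm{Aut}(\mathcal L)$ on the group $\mathcal B(\mathcal L)$ make $(\mathcal B(\mathcal L),\mathrm{Aut}(\mathcal L))$ into a group crossed module.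
   Context: All algebras are unital associative over a field $k$ and algebra maps are unital. Let $B$ be an algebra. A left $B$-bialgebroid is an algebra $\mathcal L$ with algebra maps $s:B\to\mathcal L$ (source) and $t:B^{op}\to\mathcal L$ (target) such that $s(b)t(b')=t(b')s(b)$, made a $B$-bimodule by $b.X.c=s(b)t(c)X$, together with $B$-bimodule maps $\Delta:\mathcal L\to\mathcal L\otimes_B\mathcal L$, $\Delta(X)=X_{(1)}\otimes_B X_{(2)}$, and $\varepsilon:\mathcal L\to B$ forming a $B$-coring (coassociative and counital), such that (i) $\Delta$ takes values in, and is an algebra map to, the Takeuchi product $\mathcal L\times_B\mathcal L=\{\sum_i X_i\otimes_B Y_i:\ \sum_i X_it(b)\otimes_B Y_i=\sum_i X_i\otimes_B Y_is(b)\ \forall b\in B\}$ (an algebra under factorwise multiplication); (ii) $\varepsilon(1)=1$ and $\varepsilon(Xs(\varepsilon(Y)))=\varepsilon(XY)=\varepsilon(Xt(\varepsilon(Y)))$. Here $\mathcal L\otimes_B\mathcal L$ is the quotient of $\mathcal L\otimes\mathcal L$ by the relations $t(b)X\otimes Y=X\otimes s(b)Y$. $\mathcal L$ is a left Hopf algebroid if $\lambda:\mathcal L\otimes_{B^{op}}\mathcal L\to\mathcal L\otimes_B\mathcal L$, $\lambda(X\otimes Y)=X_{(1)}\otimes_B X_{(2)}Y$ is bijective, where $\mathcal L\otimes_{B^{op}}\mathcal L$ is the quotient by $Xt(b)\otimes Y=X\otimes t(b)Y$. One writes $X_+\otimes_{B^{op}}X_-:=\lambda^{-1}(X\otimes_B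 1)$. An automorphism of $\mathcal L$ is a pair $(\Phi,\phi)$ of algebra automorphisms $\Phi:\mathcal L\to\mathcal L$, $\phi:B\to B$ with $\Phi\circ s=s\circ\phi$, $\Phi\circ t=t\circ\phi$, $(\Phi\otimes_B\Phi)\circ\Delta=\Delta\circ\Phi$, $\varepsilon\circ\Phi=\phi\circ\varepsilon$. These form the group $\mathrm{Aut}(\mathcal L)$ under composition. A left bisection on $\mathcal L$ is a unital linear map $\sigma:\mathcal L\to B$ such that (1) $\sigma(t(b)X)=\sigma(X)b$; (2) $\phi:=\sigma\circ s\in\mathrm{Aut}(B)$ (algebra automorphisms); (3) $\sigma(XY)=\sigma(Xt(\sigma(Y)))=\sigma(Xs(\phi^{-1}(\sigma(Y))))$, for all $b\in B$, $X,Y\in\mathcal L$. For a left Hopf algebroid the left bisections form a group $\mathcal B(\mathcal L)$ with product $(\sigma\ast\eta)(X)=\sigma(s(\eta(X_{(1)}))X_{(2)})$ and identity $\varepsilon$. A group crossed module $(M,N,\mu,\triangleright)$ consists of groups $M,N$, a group homomorphism $\mu:M\to N$ and a left action $\triangleright$ of $N$ on $M$ by group automorphisms such that $\mu(n\triangleright m)=n\mu(m)n^{-1}$ and $\mu(m)\triangleright m'=mm'm^{-1}$ for all $n\in N$, $m,m'\in M$. *)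

(* Defs.v *)
From HB Require Import structures.
From mathcomp Require Import all_boot all_order all_algebra.
From mathcomp Require Import boolp classical_sets.

Set Implicit Arguments.
Unset Strict Implicit.
Unset Printing Implicit Defensive.

Import GRing.Theory.
Local Open Scope ring_scope.
Local Open Scope quotient_scope.

(* [tensor f g] is the quotient of the tensor product of V and W over k by   *)
(* f i v (x) w = v (x) g i w.  A sequence of pairs stands for the sum of the *)
(* corresponding pure tensors.                                               *)

Section Tensor.
Variables (k : fieldType) (I : Type) (V W : lmodType k).
Variables (f : I -> V -> V) (g : I -> W -> W).

Definition tscale (a : k) (s : seq (V * W)) : seq (V * W) :=
  [seq (a *: p.1, p.2) | p <- s].

Inductive tens_eq : seq (V * W) -> seq (V * W) -> Prop :=
| tens_eq_refl s : tens_eq s s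
| tens_eq_sym s1 s2 : tens_eq s1 s2 -> tens_eq s2 s1
| tens_eq_trans s1 s2 s3 : tens_eq s1 s2 -> tens_eq s2 s3 -> tens_eq s1 s3
| tens_eq_cat s1 s1' s2 s2' :
    tens_eq s1 s1' -> tens_eq s2 s2' -> tens_eq (s1 ++ s2) (s1' ++ s2')
| tens_eq_scale a s1 s2 :
    tens_eq s1 s2 -> tens_eq (tscale a s1) (tscale a s2)
| tens_eq_catC s1 s2 : tens_eq (s1 ++ s2) (s2 ++ s1)
| tens_eq_0l w : tens_eq [:: (0, w)] [::]
| tens_eq_Dl v v' w : tens_eq [:: (v + v', w)] [:: (v, w); (v', w)]
| tens_eq_Dr v w w' : tens_eq [:: (v, w + w')] [:: (v, w); (v, w')]
| tens_eq_Z a v w : tens_eq [:: (a *: v, w)] [:: (v, a *: w)]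
| tens_eq_bal i v w : tens_eq [:: (f i v, w)] [:: (v, g i w)].

Definition tens_rel : rel (seq (V * W)) := fun s1 s2 => `[< tens_eq s1 s2 >].

Lemma tens_rel_refl : reflexive tens_rel.
Proof. by move=> s; apply/asboolP/tens_eq_refl. Qed.

Lemma tens_rel_sym : symmetric tens_rel.
Proof. by move=> s1 s2; apply/asboolP/asboolP; apply: tens_eq_sym. Qed.

Lemma tens_rel_trans : transitive tens_rel.
Proof.
by move=> s1 s2 s3 /asboolP h1 /asboolP h2; apply/asboolP/(tens_eq_trans h1 h2).
Qed.

Canonical tens_equiv := EquivRel tens_rel tens_rel_refl tens_rel_sym tens_rel_trans.

Definition tensor := {eq_quot tens_rel}.

HB.instance Definition _ := Choice.on tensor.

Definition tens_class (s : seq (V * W)) : tensor := \pi_tensor s.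
Definition tens_repr (z : tensor) : seq (V * W) := repr z.

Lemma tens_classP s1 s2 : tens_class s1 = tens_class s2 <-> tens_eq s1 s2.
Proof. by split=> [/eqmodP/asboolP|h]; [|apply/eqmodP/asboolP]. Qed.

Lemma tens_reprK z : tens_class (tens_repr z) = z.
Proof. exact: reprK. Qed.

Lemma tens_classK s : tens_eq (tens_repr (tens_class s)) s.
Proof. by apply/tens_classP; rewrite tens_reprK. Qed.

Definition tens_add z1 z2 := tens_class (tens_repr z1 ++ tens_repr z2).
Definition tens_scale a z := tens_class (tscale a (tens_repr z)).

Lemma tens_addE s1 s2 :
  tens_add (tens_class s1) (tens_class s2) = tens_class (s1 ++ s2).
Proof. by apply/tens_classP/tens_eq_cat; apply: tens_classK. Qed.

Lemma tens_scaleE a s : tens_scale a (tens_class s) = tens_class (tscale a s).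
Proof. by apply/tens_classP/tens_eq_scale/tens_classK. Qed.

Lemma tens_addA : associative tens_add.
Proof.
move=> z1 z2 z3; rewrite -(tens_reprK z1) -(tens_reprK z2) -(tens_reprK z3).
by rewrite !tens_addE catA.
Qed.

Lemma tens_addC : commutative tens_add.
Proof. by move=> z1 z2; apply/tens_classP/tens_eq_catC. Qed.

Lemma tens_add0 : left_id (tens_class [::]) tens_add.
Proof. by move=> z; rewrite -(tens_reprK z) tens_addE. Qed.

Lemma tens_eq_consD a b s : tens_eq (tscale (a + b) s) (tscale a s ++ tscale b s).
Proof.
elim: s => [|[v w] s IHs] /=; first exact: tens_eq_refl.
rewrite scalerDl.
apply: (@tens_eq_trans _ ([:: (a *: v, w); (b *: v, w)] ++ (tscale a s ++ tscale b s))).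
  by apply: (@tens_eq_cat [:: _]); [exact: tens_eq_Dl | exact: IHs].
apply: (@tens_eq_cat [:: _] [:: _] (_ :: _)); first exact: tens_eq_refl.
rewrite -cat1s -[X in tens_eq _ (_ ++ X)]cat1s !catA.
by apply: tens_eq_cat; [exact: tens_eq_catC | exact: tens_eq_refl].
Qed.

Lemma tens_eq_scale0 s : tens_eq (tscale 0 s) [::].
Proof.
elim: s => [|[v w] s IHs] /=; first exact: tens_eq_refl.
by rewrite scale0r; apply: (@tens_eq_cat [:: _] [::] _ [::]); [exact: tens_eq_0l|].
Qed.

Lemma tscale1 s : tscale 1 s = s.
Proof. by rewrite /tscale -[RHS]map_id; apply: eq_map => -[v w] /=; rewrite scale1r. Qed.

Lemma tens_addN : left_inverse (tens_class [::]) (tens_scale (-1)) tens_add.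
Proof.
move=> z; rewrite -(tens_reprK z) tens_scaleE tens_addE; set s := tens_repr z.
apply/tens_classP; rewrite -{2}(tscale1 s).
apply: (tens_eq_trans (tens_eq_sym (tens_eq_consD _ _ _))).
by rewrite addNr; apply: tens_eq_scale0.
Qed.

HB.instance Definition _ :=
  GRing.isZmodule.Build tensor tens_addA tens_addC tens_add0 tens_addN.

Lemma tens_scaleA a b z : tens_scale a (tens_scale b z) = tens_scale (a * b) z.
Proof.
rewrite -(tens_reprK z) !tens_scaleE /tscale -map_comp; congr tens_class.
by apply: eq_map => -[v w] /=; rewrite scalerA.
Qed.

Lemma tens_scale1 : left_id 1 tens_scale.
Proof. by move=> z; rewrite /tens_scale tscale1 tens_reprK. Qed.

Lemma tens_scaleDr : right_distributive tens_scale +%R.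
Proof.
move=> a z1 z2; rewrite -(tens_reprK z1) -(tens_reprK z2).
rewrite [_ + _]tens_addE !tens_scaleE [RHS]tens_addE.
by congr tens_class; rewrite /tscale map_cat.
Qed.

Lemma tens_scaleDl z : {morph tens_scale^~ z : a b / a + b}.
Proof.
move=> a b /=; rewrite -(tens_reprK z) !tens_scaleE [RHS]tens_addE.
by apply/tens_classP/tens_eq_consD.
Qed.

HB.instance Definition _ := GRing.Zmodule_isLmodule.Build k tensor
  tens_scaleA tens_scale1 tens_scaleDr tens_scaleDl.

Definition tens (v : V) (w : W) : tensor := tens_class [:: (v, w)].

Lemma tens_linl w : linear (tens^~ w).
Proof.
move=> a v v' /=; rewrite [X in _ = X + _]tens_scaleE [RHS]tens_addE /=.
exact/tens_classP/tens_eq_Dl.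
Qed.

Lemma tens_linr v : linear (tens v).
Proof.
move=> a w w' /=; rewrite [X in _ = X + _]tens_scaleE [RHS]tens_addE /=.
apply/tens_classP/(tens_eq_trans (tens_eq_Dr _ _ _)).
apply: (@tens_eq_cat [:: _] [:: _] [:: _] [:: _]); last exact: tens_eq_refl.
exact/tens_eq_sym/tens_eq_Z.
Qed.

Lemma tens_bal i v w : tens (f i v) w = tens v (g i w).
Proof. exact/tens_classP/tens_eq_bal. Qed.

Lemma tens_classE s : tens_class s = \sum_(p <- s) tens p.1 p.2.
Proof.
elim: s => [|[v w] s IHs]; first by rewrite big_nil.
by rewrite big_cons -IHs /= [RHS]tens_addE.
Qed.

Lemma tensE z : z = \sum_(p <- tens_repr z) tens p.1 p.2.
Proof. by rewrite -tens_classE tens_reprK. Qed.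

(* [tlift h z] is the sum of the h v w over an expression of z as a sum of   *)
(* pure tensors v (x) w; it is independent of that expression only when h is *)
(* [balanced], see [tliftE] and [tlift_linear].                              *)

Definition tlift (U : lmodType k) (h : V -> W -> U) (z : tensor) : U :=
  \sum_(p <- tens_repr z) h p.1 p.2.

Record balanced (U : lmodType k) (h : V -> W -> U) : Prop := Balanced {
  balanced_linl : forall w, linear (h^~ w);
  balanced_linr : forall v, linear (h v);
  balanced_bal : forall i v w, h (f i v) w = h v (g i w) }.

Lemma tens_balanced : balanced tens.
Proof. by split; [exact: tens_linl | exact: tens_linr | exact: tens_bal]. Qed.

Lemma tlift_tens z : tlift tens z = z.
Proof. by rewrite [RHS]tensE. Qed.

Section Balanced.
Variables (U : lmodType k) (h : V -> W -> U) (bal_h : balanced h).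

Lemma balanced_sum s1 s2 : tens_eq s1 s2 ->
  \sum_(p <- s1) h p.1 p.2 = \sum_(p <- s2) h p.1 p.2.
Proof.
have hlin w a v v' : h (a *: v + v') w = a *: h v w + h v' w.
  exact: (balanced_linl bal_h w).
have hrin v a w w' : h v (a *: w + w') = a *: h v w + h v w'.
  exact: (balanced_linr bal_h v).
have h0l w : h 0 w = 0.
  by apply: (addIr (h 0 w)); rewrite -{1}[h 0 w]scale1r -hlin scaler0 !add0r.
have h0r v : h v 0 = 0.
  by apply: (addIr (h v 0)); rewrite -{1}[h v 0]scale1r -hrin scaler0 !add0r.
have hZl a v w : h (a *: v) w = a *: h v w.
  by rewrite -[a *: v]addr0 hlin h0l addr0.
have hZr a v w : h v (a *: w) = a *: h v w.
  by rewrite -[a *: w]addr0 hrin h0r addr0.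
elim=> {s1 s2} //.
- by move=> s1 s2 s3 _ -> _ ->.
- by move=> s1 s1' s2 s2' _ e1 _ e2; rewrite !big_cat /= e1 e2.
- move=> a s1 s2 _ e.
  have hs s : \sum_(p <- tscale a s) h p.1 p.2 = a *: \sum_(p <- s) h p.1 p.2.
    by rewrite big_map scaler_sumr; apply: eq_bigr => p _; rewrite hZl.
  by rewrite !hs e.
- by move=> s1 s2; rewrite !big_cat /= addrC.
- by move=> w; rewrite big_seq1 big_nil h0l.
- move=> v v' w; rewrite big_seq1 big_cons big_seq1 /=.
  by rewrite -[v in LHS]scale1r hlin scale1r.
- move=> v w w'; rewrite big_seq1 big_cons big_seq1 /=.
  by rewrite -[w in LHS]scale1r hrin scale1r.
- by move=> a v w; rewrite !big_seq1 /= hZl hZr.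
- by move=> i v w; rewrite !big_seq1 /= (balanced_bal bal_h).
Qed.

Lemma tlift_class s : tlift h (tens_class s) = \sum_(p <- s) h p.1 p.2.
Proof. exact/balanced_sum/tens_classK. Qed.

Lemma tliftE v w : tlift h (tens v w) = h v w.
Proof. by rewrite tlift_class big_seq1. Qed.

Lemma tlift_linear : linear (tlift h).
Proof.
move=> a z z'; rewrite -[z in LHS]tens_reprK -[z' in LHS]tens_reprK.
rewrite [a *: _ in LHS]tens_scaleE [X in tlift h X]tens_addE tlift_class.
rewrite big_cat big_map scaler_sumr; congr (_ + _); apply: eq_bigr => -[v w] _ /=.
have hlin b u u' : h (b *: u + u') w = b *: h u w + h u' w.
  exact: (balanced_linl bal_h w).
have h0l : h 0 w = 0.
  by apply: (addIr (h 0 w)); rewrite -{1}[h 0 w]scale1r -hlin scaler0 !add0r.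
by rewrite -[a *: v]addr0 hlin h0l addr0.
Qed.

End Balanced.

Lemma lin_tlift (U U' : lmodType k) (u : U -> U') (h : V -> W -> U) z :
  linear u -> u (tlift h z) = tlift (fun v w => u (h v w)) z.
Proof.
move=> lu; pose u' : {linear U -> U'} := HB.pack u (GRing.isLinear.Build _ _ _ _ u lu).
exact: (linear_sum u').
Qed.

Lemma tlift_comb (U : lmodType k) (h h' : V -> W -> U) a z :
  tlift (fun v w => a *: h v w + h' v w) z = a *: tlift h z + tlift h' z.
Proof. by rewrite /tlift scaler_sumr -big_split. Qed.

End Tensor.

Arguments tens {k I V W f g}.

Notation "\tsum_ ( x , y <- z ) E" := (tlift (fun x y => E) z)
  (at level 34, E at level 41, x binder, y binder, z at level 99,
   format "\tsum_ ( x ,  y  <-  z )  E") : ring_scope.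


Section Tmap.
Variables (k : fieldType) (I J : Type) (V W V' W' : lmodType k).
Variables (f : I -> V -> V) (g : I -> W -> W).
Variables (f' : J -> V' -> V') (g' : J -> W' -> W').

Definition tmap (h1 : V -> V') (h2 : W -> W') (z : tensor f g) : tensor f' g' :=
  \tsum_(x, y <- z) tens (h1 x) (h2 y).

Lemma tlift_tmap (U : lmodType k) (h : V' -> W' -> U) h1 h2 z :
  balanced f' g' h -> tlift h (tmap h1 h2 z) = \tsum_(x, y <- z) h (h1 x) (h2 y).
Proof.
move=> bal_h; rewrite (lin_tlift _ _ (tlift_linear bal_h)).
by apply: eq_bigr => p _; rewrite tliftE.
Qed.

End Tmap.

Arguments tmap {k I J V W V' W' f g f' g'}.

Section Takeuchi.
Variables (k : fieldType) (B L : algType k) (s t : B -> L).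

Definition tensB := tensor (fun b X => t b * X) (fun b Y => s b * Y).
Definition tensBop := tensor (fun b X => X * t b) (fun b Y => t b * Y).

HB.instance Definition _ := GRing.Lmodule.on tensB.
HB.instance Definition _ := GRing.Lmodule.on tensBop.

Definition tensBl :=
  tensor (fun b (u : tensB) => tmap id (fun Y => t b * Y) u : tensB)
         (fun b Z => s b * Z).
Definition tensBr :=
  tensor (fun b X => t b * X)
         (fun b (u : tensB) => tmap (fun Y => s b * Y) id u : tensB).

Definition tensB_assoc (z : tensBl) : tensBr :=
  \tsum_(u, Z <- z) \tsum_(X, Y <- u) tens X (tens Y Z).

Definition takeuchi (u : tensB) : Prop :=
  forall b, tmap (fun X => X * t b) id u = tmap id (fun Y => Y * s b) u :> tensB.

(* The product of u and v, well-defined as soon as u is in the Takeuchi      *)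
(* product.                                                                  *)
Definition takeuchi_mul (u v : tensB) : tensB :=
  \tsum_(X', Y' <- v) tmap (fun X => X * X') (fun Y => Y * Y') u.

End Takeuchi.

(* B^c is the opposite algebra of B; every \tsum and tmap below is taken of  *)
(* a balanced map.                                                           *)
Record left_bialgebroid (k : fieldType) (B L : algType k) := LeftBialgebroid {
  src : {lrmorphism B -> L};
  tgt : {linear B -> L};
  tgt_monoid : monoid_morphism (tgt : B^c -> L);
  src_tgtC : forall b c, src b * tgt c = tgt c * src b;
  cop : {linear L -> tensB src tgt};
  cou : {linear L -> B};
  cop_bimod : forall b c X, cop (src b * tgt c * X) =
    tmap (fun Y => src b * Y) (fun Y => tgt c * Y) (cop X);
  cou_bimod : forall b c X, cou (src b * tgt c * X) = b * cou X * c;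
  cop_coassoc : forall X,
    tensB_assoc (tmap cop id (cop X)) = tmap id cop (cop X);
  cou_copl : forall X, \tsum_(X1, X2 <- cop X) (src (cou X1) * X2) = X;
  cou_copr : forall X, \tsum_(X1, X2 <- cop X) (tgt (cou X2) * X1) = X;
  cop_takeuchi : forall X, takeuchi (cop X);
  cop1 : cop 1 = tens 1 1;
  copM : forall X Y, cop (X * Y) = takeuchi_mul (cop X) (cop Y);
  cou1 : cou 1 = 1;
  couMs : forall X Y, cou (X * src (cou Y)) = cou (X * Y);
  couMt : forall X Y, cou (X * tgt (cou Y)) = cou (X * Y) }.

Section HopfAlgebroid.
Variables (k : fieldType) (B L : algType k).

Definition hopf_map (H : left_bialgebroid B L)
    (u : tensBop (tgt H)) : tensB (src H) (tgt H) :=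
  \tsum_(X, Y <- u) tmap id (fun Z => Z * Y) (cop H X).

Record left_hopf_algebroid := LeftHopfAlgebroid {
  hopf_bialgebroid :> left_bialgebroid B L;
  hopf_map_bij : bijective (@hopf_map hopf_bialgebroid) }.

End HopfAlgebroid.

(* The inverse of f when f is bijective. *)
Definition inv_map (U V : zmodType) (f : U -> V) (y : V) : U :=
  xget 0 [set x | f x = y].

(* X |-> X_+ (x)_{B^op} X_- *)
Definition translation (k : fieldType) (B L : algType k)
    (H : left_hopf_algebroid B L) (X : L) : tensBop (tgt H) :=
  inv_map (@hopf_map k B L H) (tens X 1).

Definition algebra_automorphism (k : fieldType) (A : algType k) (f : A -> A) :=
  [/\ linear f, monoid_morphism f & bijective f].

Section Bisection.
Variables (k : fieldType) (B L : algType k) (H : left_hopf_algebroid B L).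
Local Notation s := (src H).
Local Notation t := (tgt H).

Record is_left_bisection (sigma : L -> B) : Prop := IsLeftBisection {
  bis_linear : linear sigma;
  bis1 : sigma 1 = 1;
  bis_t : forall b X, sigma (t b * X) = sigma X * b;
  bis_aut : algebra_automorphism (sigma \o s);
  bisMt : forall X Y, sigma (X * Y) = sigma (X * t (sigma Y));
  bisMs : forall X Y,
    sigma (X * Y) = sigma (X * s (inv_map (sigma \o s) (sigma Y))) }.

Record left_bisection := LeftBisection {
  bis_fun :> L -> B;
  bisP : is_left_bisection bis_fun }.

Record is_hopf_aut (Phi : L -> L) (phi : B -> B) : Prop := IsHopfAut {
  aut_total : algebra_automorphism Phi;
  aut_base : algebra_automorphism phi;
  aut_src : forall b, Phi (s b) = s (phi b);
  aut_tgt : forall b, Phi (t b) = t (phi b);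
  aut_cop : forall X, tmap Phi Phi (cop H X) = cop H (Phi X);
  aut_cou : forall X, cou H (Phi X) = phi (cou H X) }.

Record hopf_aut := HopfAut {
  autL : L -> L;
  autB : B -> B;
  autP : is_hopf_aut autL autB }.

Definition bis_mul_fun (sigma eta : L -> B) (X : L) : B :=
  \tsum_(X1, X2 <- cop H X) sigma (s (eta X1) * X2).

Definition bis_inv_fun (sigma : L -> B) (X : L) : B :=
  inv_map (sigma \o s)
    (cou H (\tsum_(Xp, Xm <- translation H X) (Xp * t (sigma Xm)))).

End Bisection.

Record crossed_module (M N : groupType) (mu : M -> N) (act : N -> M -> M) :
    Prop := CrossedModule {
  crossed_morph : {morph mu : m m' / (m * m')%g};
  crossed_act1 : forall m, act 1%g m = m;
  crossed_actM : forall n n' m, act (n * n')%g m = act n (act n' m);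
  crossed_act_morph : forall n, {morph act n : m m' / (m * m')%g};
  crossed_equiv : forall n m, mu (act n m) = (n * mu m * n^-1)%g;
  crossed_peiffer : forall m m', act (mu m) m' = (m * m' * m^-1)%g }.
Section Theory.
Variables (k : fieldType) (B L : algType k).

Lemma eq_tlift (I : Type) (V W U : lmodType k) (f : I -> V -> V) (g : I -> W -> W)
    (h h' : V -> W -> U) (z : tensor f g) :
  (forall v w, h v w = h' v w) -> tlift h z = tlift h' z.
Proof. by move=> e; apply: eq_bigr => p _; apply: e. Qed.

Lemma inv_mapK (U V : zmodType) (f : U -> V) : bijective f -> cancel f (inv_map f).
Proof.
move=> bf x; apply: (bij_inj bf); rewrite /inv_map.
by apply: (@xgetPex _ 0 [set y | f y = f x]); exists x.
Qed.

Lemma inv_mapKV (U V : zmodType) (f : U -> V) : bijective f -> cancel (inv_map f) f.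
Proof.
case=> g fK gK y; rewrite /inv_map.
by apply: (@xgetPex _ 0 [set x | f x = y]); exists (g y) => /=.
Qed.

Lemma inv_map_bij (U V : zmodType) (f : U -> V) : bijective f -> bijective (inv_map f).
Proof. by move=> bf; exists f; [exact: inv_mapKV | exact: inv_mapK]. Qed.

Section Bialgebroid.
Variable H : left_bialgebroid B L.
Local Notation s := (src H).
Local Notation t := (tgt H).
Local Notation D := (cop H).
Local Notation eps := (cou H).
Local Notation balB := (balanced (fun b X => t b * X) (fun b Y => s b * Y)).
Local Notation balBop := (balanced (fun b X => X * t b) (fun b Y => t b * Y)).

Lemma tgt1 : t 1 = 1. Proof. exact: (tgt_monoid H).1. Qed.
Lemma tgtM b c : t (b * c) = t c * t b. Proof. exact: (tgt_monoid H).2. Qed.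

Lemma tensB_tens : balB (tens : L -> L -> tensB s t).
Proof. exact: tens_balanced. Qed.

Lemma balB_mul (U : lmodType k) (h : L -> L -> U) (X Y : L) :
  balB h -> balanced (fun b X => t b * X) (fun b Y => s b * Y)
                     (fun x y => h (x * X) (y * Y)).
Proof.
move=> [hl hr hb]; split=> [w a x y|v a x y|b v w].
- by rewrite mulrDl -scalerAl hl.
- by rewrite mulrDl -scalerAl hr.
- by rewrite -!mulrA hb.
Qed.

Lemma cop_bimod_lift (U : lmodType k) (h : L -> L -> U) b c X : balB h ->
  tlift h (D (s b * t c * X)) = \tsum_(X1, X2 <- D X) h (s b * X1) (t c * X2).
Proof. by move=> bh; rewrite cop_bimod tlift_tmap. Qed.

Lemma cop_sl (U : lmodType k) (h : L -> L -> U) b X : balB h ->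
  tlift h (D (s b * X)) = \tsum_(X1, X2 <- D X) h (s b * X1) X2.
Proof.
move=> bh; rewrite -[s b]mulr1 -tgt1 cop_bimod_lift //.
by apply: eq_tlift => x y; rewrite tgt1 mul1r mulr1.
Qed.

Lemma cop_tl (U : lmodType k) (h : L -> L -> U) c X : balB h ->
  tlift h (D (t c * X)) = \tsum_(X1, X2 <- D X) h X1 (t c * X2).
Proof.
move=> bh; rewrite -[t c]mul1r -(rmorph1 s) cop_bimod_lift //.
by apply: eq_tlift => x y; rewrite !rmorph1 !mul1r.
Qed.

Lemma cop_src b : D (s b) = tens (s b) 1.
Proof.
rewrite -[LHS]tlift_tens -[in LHS](mulr1 (s b)) (cop_sl _ _ tensB_tens) cop1.
rewrite tliftE ?mulr1 //; split=> [w a x y|v a x y|c v w].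
- by rewrite mulrDr -scalerAr tens_linl.
- by rewrite tens_linr.
- by rewrite mulrA src_tgtC -mulrA tens_bal.
Qed.

Lemma cop_tgt b : D (t b) = tens 1 (t b).
Proof.
rewrite -[LHS]tlift_tens -[in LHS](mulr1 (t b)) (cop_tl _ _ tensB_tens) cop1.
rewrite tliftE ?mulr1 //; split=> [w a x y|v a x y|c v w].
- by rewrite tens_linl.
- by rewrite mulrDr -scalerAr tens_linr.
- by rewrite mulrA -src_tgtC -mulrA tens_bal.
Qed.

Lemma takeuchi_lift (U : lmodType k) (h : L -> L -> U) b X : balB h ->
  \tsum_(X1, X2 <- D X) h (X1 * t b) X2 = \tsum_(X1, X2 <- D X) h X1 (X2 * s b).
Proof.
move=> bh; have /(congr1 (tlift h)) := cop_takeuchi H X b.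
by rewrite !tlift_tmap.
Qed.

Lemma takeuchi_mul_balanced X :
  balB (fun X' Y' => tmap (fun x => x * X') (fun y => y * Y') (D X) : tensB s t).
Proof.
split=> [w a x y|v a x y|b v w] /=.
- rewrite /tmap -tlift_comb; apply: eq_tlift => x1 x2.
  by rewrite mulrDr -scalerAr tens_linl.
- rewrite /tmap -tlift_comb; apply: eq_tlift => x1 x2.
  by rewrite mulrDr -scalerAr tens_linr.
- rewrite /tmap.
  under eq_tlift do rewrite mulrA.
  rewrite (takeuchi_lift b X (balB_mul v w tensB_tens)).
  by apply: eq_tlift => x y; rewrite mulrA.
Qed.

Lemma copM_lift (U : lmodType k) (h : L -> L -> U) X Y : balB h ->
  tlift h (D (X * Y)) =
  \tsum_(Y1, Y2 <- D Y) \tsum_(X1, X2 <- D X) h (X1 * Y1) (X2 * Y2).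
Proof.
move=> bh; rewrite copM /takeuchi_mul (lin_tlift _ _ (tlift_linear bh)).
by apply: eq_tlift => x y; rewrite tlift_tmap.
Qed.

Lemma cop_mul_tens (U : lmodType k) (h : L -> L -> U) X Y Y1 Y2 : balB h ->
  D Y = tens Y1 Y2 ->
  tlift h (D (X * Y)) = \tsum_(X1, X2 <- D X) h (X1 * Y1) (X2 * Y2).
Proof.
move=> bh eY; rewrite copM eY /takeuchi_mul tliftE; last exact: takeuchi_mul_balanced.
by rewrite tlift_tmap.
Qed.

Lemma cop_sr (U : lmodType k) (h : L -> L -> U) b X : balB h ->
  tlift h (D (X * s b)) = \tsum_(X1, X2 <- D X) h (X1 * s b) X2.
Proof.
move=> bh; rewrite (cop_mul_tens _ bh (cop_src b)).
by apply: eq_tlift => x y; rewrite mulr1.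
Qed.

Lemma cop_tr (U : lmodType k) (h : L -> L -> U) b X : balB h ->
  tlift h (D (X * t b)) = \tsum_(X1, X2 <- D X) h X1 (X2 * t b).
Proof.
move=> bh; rewrite (cop_mul_tens _ bh (cop_tgt b)).
by apply: eq_tlift => x y; rewrite mulr1.
Qed.

(* Well-definedness of the left and right actions on L (x)_B L, of the      *)
(* associator and of the Hopf map.                                           *)

Lemma tensB_actr_balanced c : balB (fun X Y => tens X (t c * Y) : tensB s t).
Proof.
split=> [w a x y|v a x y|b v w].
- by rewrite tens_linl.
- by rewrite mulrDr -scalerAr tens_linr.
- by rewrite tens_bal !mulrA src_tgtC.
Qed.

Lemma tensB_actl_balanced c : balB (fun X Y => tens (s c * X) Y : tensB s t).
Proof.
split=> [w a x y|v a x y|b v w].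
- by rewrite mulrDr -scalerAr tens_linl.
- by rewrite tens_linr.
- by rewrite mulrA src_tgtC -mulrA tens_bal.
Qed.

Lemma tensB_assoc_balanced_in Z :
  balB (fun X Y => tens X (tens Y Z) : tensBr s t).
Proof.
split=> [w a x y|v a x y|b v w].
- by rewrite tens_linl.
- by rewrite tens_linl tens_linr.
- by rewrite tens_bal /tmap tliftE //; exact: tensB_actl_balanced.
Qed.

Lemma tensB_assoc_balanced :
  balanced (fun b (u : tensB s t) => tmap id (fun Y => t b * Y) u : tensB s t)
    (fun b Z => s b * Z)
    (fun u Z => \tsum_(X, Y <- u) tens X (tens Y Z) : tensBr s t).
Proof.
split=> [w|v a x y|b v w].
- exact/tlift_linear/tensB_assoc_balanced_in.
- by rewrite -tlift_comb; apply: eq_tlift => x1 x2; rewrite tens_linr tens_linr.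
- rewrite tlift_tmap; last exact: tensB_assoc_balanced_in.
  by apply: eq_tlift => x y; rewrite tens_bal.
Qed.

Lemma cop_coassoc_lift (U : lmodType k) (h : L -> L -> L -> U) X :
    (forall x, balB (h x)) -> (forall z, balB (fun x y => h x y z)) ->
  \tsum_(X1, X2 <- D X) \tsum_(x, y <- D X1) h x y X2 =
  \tsum_(X1, X2 <- D X) \tsum_(x, y <- D X2) h X1 x y.
Proof.
move=> bl br.
have bG : balanced (fun b X => t b * X)
    (fun b (u : tensB s t) => tmap (fun Y => s b * Y) id u : tensB s t)
    (fun x u => tlift (h x) u).
  split=> [w a x y|v|b v w].
  - rewrite -tlift_comb; apply: eq_tlift => x1 x2.
    exact: (balanced_linl (br x2)).
  - exact: tlift_linear.
  - rewrite tlift_tmap //; apply: eq_tlift => x y.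
    exact: (balanced_bal (br y)).
have /(congr1 (tlift (fun x u => tlift (h x) u))) := cop_coassoc H X.
rewrite [in RHS]tlift_tmap // => <-.
rewrite /tensB_assoc (lin_tlift _ _ (tlift_linear bG)).
have bK : balanced (fun b (u : tensB s t) => tmap id (fun Y => t b * Y) u : tensB s t)
    (fun b Z => s b * Z) (fun u Z => tlift (fun x y => h x y Z) u).
  split=> [w|v a x y|b v w].
  - exact: tlift_linear.
  - rewrite -tlift_comb; apply: eq_tlift => x1 x2.
    exact: (balanced_linr (bl x1)).
  - rewrite tlift_tmap //; apply: eq_tlift => x y.
    exact: (balanced_bal (bl x)).
rewrite -[LHS]/(tlift (fun X1 X2 => tlift (fun x y => h x y X2) (D (id X1))) (D X)).
rewrite -(tlift_tmap D id (D X) bK); apply: eq_tlift => u Z.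
rewrite (lin_tlift _ _ (tlift_linear bG)); apply: eq_tlift => x y.
by rewrite (tliftE bG) tliftE.
Qed.

Lemma hopf_map_balanced :
  balBop (fun X Y => tmap id (fun Z => Z * Y) (D X) : tensB s t).
Proof.
have bY Y : balB (fun x y => tens (id x) (y * Y) : tensB s t).
  split=> [w a x y|v a x y|b v w] /=.
  - by rewrite tens_linl.
  - by rewrite mulrDl -scalerAl tens_linr.
  - by rewrite -mulrA tens_bal.
split=> [w a x y|v a x y|b v w] /=.
- by rewrite /tmap linearP (tlift_linear (bY w)).
- rewrite /tmap -tlift_comb; apply: eq_tlift => x1 x2.
  by rewrite mulrDr -scalerAr tens_linr.
- rewrite /tmap (cop_tr _ _ (bY w)); apply: eq_tlift => x y.
  by rewrite mulrA.
Qed.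

Lemma hopf_map_linear : linear (@hopf_map k B L H).
Proof. exact/tlift_linear/hopf_map_balanced. Qed.

Lemma hopf_map_tens X Y :
  hopf_map (tens X Y : tensBop t) = tmap id (fun Z => Z * Y) (D X).
Proof. by rewrite /hopf_map tliftE //; exact: hopf_map_balanced. Qed.

End Bialgebroid.

Section HopfAlgebroidTheory.
Variable H : left_hopf_algebroid B L.
Local Notation s := (src H).
Local Notation t := (tgt H).
Local Notation D := (cop H).
Local Notation eps := (cou H).
Local Notation T := (translation H).
Local Notation balB := (balanced (fun b X => t b * X) (fun b Y => s b * Y)).
Local Notation balBop := (balanced (fun b X => X * t b) (fun b Y => t b * Y)).
Local Notation hmap := (@hopf_map k B L H).

Lemma translationK X : hmap (T X) = tens X 1.
Proof. exact/inv_mapKV/hopf_map_bij. Qed.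

Lemma translation_eq X u : hmap u = tens X 1 -> T X = u.
Proof. by move=> e; apply: (bij_inj (hopf_map_bij H)); rewrite translationK. Qed.

Lemma translation_linear : linear T.
Proof.
move=> a X Y; apply: translation_eq.
by rewrite hopf_map_linear !translationK tens_linl.
Qed.

Lemma hopf_map_lift (U : lmodType k) (h : L -> L -> U) (u : tensBop t) : balB h ->
  tlift h (hmap u) = \tsum_(X, Y <- u) \tsum_(X1, X2 <- D X) h X1 (X2 * Y).
Proof.
move=> bh; rewrite /hopf_map (lin_tlift _ _ (tlift_linear bh)).
by apply: eq_tlift => x y; rewrite tlift_tmap.
Qed.

Lemma translation_lift (U : lmodType k) (h : L -> L -> U) X : balB h ->
  \tsum_(Xp, Xm <- T X) \tsum_(X1, X2 <- D Xp) h X1 (X2 * Xm) = h X 1.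
Proof. by move=> bh; rewrite -hopf_map_lift // translationK tliftE. Qed.

Lemma hmap_tmap h1 h2 (u : tensBop t) :
  hmap (tmap h1 h2 u) =
  \tsum_(X, Y <- u) \tsum_(X1, X2 <- D (h1 X)) tens X1 (X2 * h2 Y).
Proof. by rewrite /hopf_map tlift_tmap //; exact: hopf_map_balanced. Qed.

Lemma tensB_mulr_balanced Y : balB (fun x y => tens x (y * Y) : tensB s t).
Proof.
split=> [w a x y|v a x y|b v w] /=.
- by rewrite tens_linl.
- by rewrite mulrDl -scalerAl tens_linr.
- by rewrite -mulrA tens_bal.
Qed.

Lemma translation1 : T 1 = tens 1 1.
Proof.
apply: translation_eq; rewrite hopf_map_tens cop1 /tmap tliftE ?mulr1 //.
exact: tensB_mulr_balanced.
Qed.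

Lemma translation_sl b X : T (s b * X) = tmap (fun Y => s b * Y) id (T X).
Proof.
apply: translation_eq; rewrite hmap_tmap.
rewrite -(translation_lift X (tensB_actl_balanced H b)).
by apply: eq_tlift => x y; rewrite (cop_sl _ _ (tensB_mulr_balanced y)).
Qed.

Lemma translation_tl b X : T (t b * X) = tmap id (fun Y => Y * s b) (T X).
Proof.
apply: translation_eq; rewrite hmap_tmap.
rewrite tens_bal mulr1 -[s b]mul1r.
rewrite -(translation_lift X (tensB_mulr_balanced (s b))).
by apply: eq_tlift => x y; apply: eq_tlift => v w; rewrite mul1r mulrA.
Qed.

Lemma translation_takeuchi b X :
  tmap (fun Y => t b * Y) id (T X) = tmap id (fun Y => Y * t b) (T X) :> tensBop t.
Proof.
apply: (bij_inj (hopf_map_bij H)); rewrite !hmap_tmap.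
transitivity (tens X (t b) : tensB s t).
  rewrite -[t b in RHS]mulr1.
  rewrite -(translation_lift X (tensB_actr_balanced H b)).
  apply: eq_tlift => x y; rewrite (cop_tl _ _ (tensB_mulr_balanced y)).
  by apply: eq_tlift => v w; rewrite mulrA.
rewrite -[t b in LHS]mul1r -(translation_lift X (tensB_mulr_balanced (t b))).
by apply: eq_tlift => x y; apply: eq_tlift => v w; rewrite mulrA.
Qed.

Lemma translationM X Y : T (X * Y) =
  \tsum_(Xp, Xm <- T X) \tsum_(Yp, Ym <- T Y) tens (Xp * Yp) (Ym * Xm).
Proof.
apply: translation_eq.
rewrite (lin_tlift _ _ (hopf_map_linear (H := H))).
have bY : balB (fun x y => tens (x * Y) y : tensB s t).
  split=> [w a x y|v a x y|b v w].
  - by rewrite mulrDl -scalerAl tens_linl.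
  - by rewrite tens_linr.
  - by rewrite -mulrA tens_bal.
rewrite -(translation_lift X bY); apply: eq_tlift => p m.
rewrite (lin_tlift _ _ (hopf_map_linear (H := H))).
pose h a b : tensB s t := \tsum_(x, y <- D p) tens (x * a) (y * b * m).
have bh : balB h.
  split=> [w a x y|v a x y|b v w]; rewrite /h.
  - rewrite -tlift_comb; apply: eq_tlift => x1 x2.
    by rewrite mulrDr -scalerAr tens_linl.
  - rewrite -tlift_comb; apply: eq_tlift => x1 x2.
    by rewrite mulrDr -scalerAr mulrDl -scalerAl tens_linr.
  - transitivity (\tsum_(x, y <- D p) tens (x * t b * v) (y * (w * m)) : tensB s t).
      by apply: eq_tlift => x y; rewrite !mulrA.
    rewrite (takeuchi_lift b p (balB_mul v (w * m) (tensB_tens H))).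
    by apply: eq_tlift => x y; rewrite !mulrA.
transitivity (h Y 1); last by apply: eq_tlift => x y; rewrite mulr1.
rewrite -(translation_lift Y bh); apply: eq_tlift => p' m'.
rewrite hopf_map_tens /tmap (copM_lift _ _ (tensB_mulr_balanced (m' * m))).
by apply: eq_tlift => x y; apply: eq_tlift => v w; rewrite !mulrA.
Qed.

Lemma translation_cou X : \tsum_(Xp, Xm <- T X) (Xp * Xm) = s (eps X).
Proof.
have bh : balB (fun x y => s (eps x) * y).
  split=> [w a x y|v a x y|b v w].
  - by rewrite !linearP mulrDl -scalerAl.
  - by rewrite mulrDr -scalerAr.
  - have := cou_bimod H 1 b v; rewrite rmorph1 !mul1r => ->.
    by rewrite rmorphM mulrA.
rewrite -[RHS]mulr1 -(translation_lift X bh); apply: eq_tlift => p m.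
rewrite -[p in LHS](cou_copl H p) [in LHS](lin_tlift (u := fun z => z * m)).
  by apply: eq_tlift => x y; rewrite mulrA.
by move=> a x y; rewrite mulrDl scalerAl.
Qed.

(* X_(1) (x) X_(2)+ (x) X_(2)- = X_+(1) (x) X_+(2) (x) X_- *)
Lemma translation_cop (U : lmodType k) (h : L -> L -> L -> U) X :
    (forall x, balBop (h x)) -> (forall z, balB (fun x y => h x y z)) ->
  \tsum_(X1, X2 <- D X) \tsum_(x, y <- T X2) h X1 x y =
  \tsum_(x, y <- T X) \tsum_(X1, X2 <- D x) h X1 X2 y.
Proof.
move=> bop bb.
pose T' := inv_map hmap.
have T'lin : linear T'.
  move=> a x y; apply: (bij_inj (hopf_map_bij H)).
  by rewrite hopf_map_linear !inv_mapKV //; exact: hopf_map_bij.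
have bG Y : balB (fun x z => tlift (h x) (T' (tens z Y))).
  split=> [w a x y|v a x y|b v w].
  - rewrite -tlift_comb; apply: eq_tlift => x1 x2.
    exact: (balanced_linl (bb x2)).
  - by rewrite tens_linl T'lin (tlift_linear (bop v)).
  - have -> : T' (tens (s b * w) Y) = tmap (fun x => s b * x) id (T' (tens w Y)).
      apply: (bij_inj (hopf_map_bij H)); rewrite inv_mapKV; last exact: hopf_map_bij.
      rewrite hmap_tmap.
      have <- : tlift (fun x y => tens (s b * x) y : tensB s t) (hmap (T' (tens w Y))) = tens (s b * w) Y.
        rewrite inv_mapKV; last exact: hopf_map_bij.
        rewrite tliftE //; exact: tensB_actl_balanced.
      rewrite hopf_map_lift; last exact: tensB_actl_balanced.
      by apply: eq_tlift => x y; rewrite (cop_sl _ _ (tensB_mulr_balanced y)).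
    rewrite tlift_tmap //; apply: eq_tlift => x y.
    exact: (balanced_bal (bb y)).
pose C Z Y := \tsum_(X1, X2 <- D Z) tlift (h X1) (T' (tens X2 Y)).
have bC : balB C.
  split=> [w a x y|v a x y|b v w]; rewrite /C.
  - by rewrite linearP (tlift_linear (bG w)).
  - rewrite -tlift_comb; apply: eq_tlift => x1 x2.
    by rewrite tens_linr T'lin (tlift_linear (bop x1)).
  - rewrite (cop_tl _ _ (bG w)); apply: eq_tlift => x y.
    by rewrite tens_bal.
rewrite -[LHS]/(C X 1) -(translation_lift X bC).
apply: eq_tlift => p m; rewrite /C.
rewrite (cop_coassoc_lift (h := fun x y z => tlift (h x) (T' (tens y (z * m))))).
- apply: eq_tlift => x y.
  have lT' : linear (fun z => tlift (h x) (T' z)).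
    by move=> a u v; rewrite T'lin (tlift_linear (bop x)).
  have e : T' (hmap (tens y m)) = tens y m by rewrite [T' _]inv_mapK //; exact: hopf_map_bij.
  rewrite -[RHS](tliftE (bop x)) -e hopf_map_tens /tmap.
  by rewrite (lin_tlift (u := fun z => tlift (h x) (T' z))).
- move=> x; split=> [w a u v|v a u w|b v w].
  + by rewrite tens_linl T'lin (tlift_linear (bop x)).
  + by rewrite mulrDl -scalerAl tens_linr T'lin (tlift_linear (bop x)).
  + by rewrite -mulrA tens_bal.
- by move=> z; exact: bG.
Qed.

End HopfAlgebroidTheory.

Section BisectionTheory.
Variable H : left_hopf_algebroid B L.
Local Notation s := (src H).
Local Notation t := (tgt H).
Local Notation D := (cop H).
Local Notation eps := (cou H).
Local Notation T := (translation H).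
Local Notation balB := (balanced (fun b X => t b * X) (fun b Y => s b * Y)).
Local Notation balBop := (balanced (fun b X => X * t b) (fun b Y => t b * Y)).

Lemma cou_s b X : eps (s b * X) = b * eps X.
Proof. by have := cou_bimod H b 1 X; rewrite tgt1 !mulr1. Qed.

Lemma cou_t b X : eps (t b * X) = eps X * b.
Proof. by have := cou_bimod H 1 b X; rewrite rmorph1 !mul1r. Qed.

Lemma cou_s1 b : eps (s b) = b.
Proof. by have := cou_s b 1; rewrite cou1 !mulr1. Qed.

Lemma cou_t1 b : eps (t b) = b.
Proof. by have := cou_t b 1; rewrite cou1 mulr1 mul1r. Qed.

Section OneBisection.
Variables (sigma : L -> B) (sP : is_left_bisection H sigma).
Local Notation phi := (sigma \o s).

Lemma bis_s b : sigma (s b) = phi b. Proof. by []. Qed.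

Lemma bis_t1 b : sigma (t b) = b.
Proof. by rewrite -[t b]mulr1 (bis_t sP) (bis1 sP) mul1r. Qed.

Lemma bis_sr b X : sigma (X * s b) = sigma (X * t (phi b)).
Proof. exact: (bisMt sP). Qed.

Lemma bis_sl b X : sigma (s b * X) = phi b * sigma X.
Proof. by rewrite (bisMt sP) src_tgtC (bis_t sP). Qed.

Lemma base_bij : bijective phi. Proof. by case: (bis_aut sP). Qed.

Lemma bis_mul_balanced (eta : L -> B) : is_left_bisection H eta ->
  balB (fun x y => sigma (s (eta x) * y)).
Proof.
move=> eP; split=> [w a x y|v a x y|b v w].
- by rewrite (bis_linear eP) !linearP mulrDl -scalerAl (bis_linear sP).
- by rewrite mulrDr -scalerAr (bis_linear sP).
- by rewrite (bis_t eP) rmorphM mulrA.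
Qed.

Lemma bis_Xp_Xm_balanced : balBop (fun x y => x * t (sigma y)).
Proof.
split=> [w a x y|v a x y|b v w].
- by rewrite mulrDl -scalerAl.
- by rewrite (bis_linear sP) !linearP mulrDr -scalerAr.
- by rewrite (bis_t sP) tgtM mulrA.
Qed.

(* Together with [bis_Xp_Xm_balanced], [Ad_balanced] below is the             *)
(* well-definedness of s(sigma(X_(1))) X_(2)+ t(sigma(X_(2)-)).               *)
Definition theta (X : L) : L := \tsum_(Xp, Xm <- T X) (Xp * t (sigma Xm)).

Lemma theta_linear : linear theta.
Proof.
move=> a X Y.
by rewrite /theta translation_linear (tlift_linear bis_Xp_Xm_balanced).
Qed.

Lemma thetaM X Y : theta (X * Y) = theta X * theta Y.
Proof.
rewrite /theta translationM (lin_tlift _ _ (tlift_linear bis_Xp_Xm_balanced)).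
rewrite [RHS](lin_tlift (u := fun z => z * _)); last first.
  by move=> a x y; rewrite mulrDl scalerAl.
apply: eq_tlift => p m; rewrite (lin_tlift _ _ (tlift_linear bis_Xp_Xm_balanced)).
rewrite [RHS](lin_tlift (u := fun z => _ * z)); last first.
  by move=> a x y; rewrite mulrDr scalerAr.
transitivity (\tsum_(x, y <- T Y) (p * x * t (sigma (y * t (sigma m))))).
  by apply: eq_tlift => x y; rewrite (tliftE bis_Xp_Xm_balanced) -(bisMt sP).
have bp : balBop (fun x y => p * x * t (sigma y)).
  split=> [w a x y|v a x y|b v w].
  - by rewrite mulrDr mulrDl -scalerAr -scalerAl.
  - by rewrite (bis_linear sP) !linearP mulrDr -scalerAr.
  - by rewrite (bis_t sP) tgtM !mulrA.
have /(congr1 (tlift (fun x y => p * x * t (sigma y)))) :=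
  translation_takeuchi H (sigma m) Y.
rewrite !tlift_tmap // => <-.
by apply: eq_tlift => x y; rewrite !mulrA.
Qed.

Lemma theta1 : theta 1 = 1.
Proof.
by rewrite /theta translation1 (tliftE bis_Xp_Xm_balanced) (bis1 sP) tgt1 mulr1.
Qed.

Lemma theta_sl b X : theta (s b * X) = s b * theta X.
Proof.
rewrite /theta translation_sl tlift_tmap; last exact: bis_Xp_Xm_balanced.
rewrite [RHS](lin_tlift (u := fun z => _ * z)).
  by apply: eq_tlift => x y; rewrite mulrA.
by move=> a x y; rewrite mulrDr scalerAr.
Qed.

Lemma theta_s b : theta (s b) = s b.
Proof. by rewrite -[s b]mulr1 theta_sl theta1. Qed.

Lemma theta_t b : theta (t b) = t (phi b).
Proof.
rewrite /theta -[t b]mulr1 translation_tl translation1.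
rewrite tlift_tmap; last exact: bis_Xp_Xm_balanced.
rewrite tliftE ?mul1r //; split=> [w a x y|v a x y|c v w] /=.
- by rewrite mulrDl -scalerAl.
- by rewrite mulrDl -scalerAl (bis_linear sP) !linearP mulrDr -scalerAr.
- by rewrite -!mulrA (bis_t sP) tgtM.
Qed.

Lemma Ad_balanced : balB (fun x y => s (sigma x) * theta y).
Proof.
split=> [w a x y|v a x y|b v w].
- by rewrite (bis_linear sP) !linearP mulrDl -scalerAl.
- by rewrite theta_linear mulrDr -scalerAr.
- by rewrite (bis_t sP) rmorphM theta_sl mulrA.
Qed.

Lemma bis_cou_lift X : \tsum_(X1, X2 <- D X) (sigma X1 * eps X2) = sigma X.
Proof.
rewrite -[X in RHS](cou_copr H X) (lin_tlift _ _ (bis_linear sP)).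
by apply: eq_tlift => x y; rewrite (bis_t sP).
Qed.

Lemma bis_theta X : \tsum_(X1, X2 <- D X) (sigma X1 * eps (theta X2)) = phi (eps X).
Proof.
have bse : balB (fun x y => sigma x * eps y).
  split=> [w a x y|v a x y|b v w].
  - by rewrite (bis_linear sP) mulrDl -scalerAl.
  - by rewrite linearP mulrDr -scalerAr.
  - by rewrite (bis_t sP) cou_s mulrA.
transitivity (\tsum_(X1, X2 <- D X) \tsum_(x, y <- T X2) (sigma X1 * eps (x * t (sigma y)))).
  apply: eq_tlift => x y; rewrite /theta (lin_tlift (u := fun z => sigma x * eps z)) //.
  by move=> a u v; rewrite linearP mulrDr -scalerAr.
rewrite (translation_cop (h := fun X1 x y => sigma X1 * eps (x * t (sigma y)))).
- rewrite /= -(translation_cou H X).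
  rewrite (lin_tlift _ _ (bis_linear sP)).
  apply: eq_tlift => p m; rewrite (bisMt sP) -[RHS]bis_cou_lift.
  by rewrite (cop_tr _ _ bse).
- move=> X1; split=> [w a x y|v a x y|b v w].
  + by rewrite mulrDl -scalerAl linearP mulrDr -scalerAr.
  + by rewrite (bis_linear sP) linearP mulrDr -scalerAr linearP mulrDr -scalerAr.
  + by rewrite (bis_t sP) tgtM mulrA.
- move=> z; split=> [w a x y|v a x y|b v w].
  + by rewrite (bis_linear sP) mulrDl -scalerAl.
  + by rewrite mulrDl -scalerAl linearP mulrDr -scalerAr.
  + by rewrite (bis_t sP) -[s b * _ * _]mulrA cou_s mulrA.
Qed.

Lemma inv_base_aut : algebra_automorphism (inv_map phi).
Proof.
have [lp [p1 pM] bp] := bis_aut sP.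
split; last exact: inv_map_bij.
  move=> a x y; apply: (bij_inj bp).
  by rewrite lp !inv_mapKV.
split; first by apply: (bij_inj bp); rewrite inv_mapKV.
by move=> x y; apply: (bij_inj bp); rewrite pM !inv_mapKV.
Qed.

Lemma bis_inv_s b : bis_inv_fun H sigma (s b) = inv_map phi b.
Proof. by rewrite /bis_inv_fun -/(theta _) theta_s cou_s1. Qed.

Lemma bis_inv_isP : is_left_bisection H (bis_inv_fun H sigma).
Proof.
have [lp [p1 pM] bp] := bis_aut sP.
have [lq [q1 qM] bq] := inv_base_aut.
have es : bis_inv_fun H sigma \o s = inv_map phi by apply/funext => b; exact: bis_inv_s.
have eM X Y : bis_inv_fun H sigma (X * Y) =
    bis_inv_fun H sigma (X * t (bis_inv_fun H sigma Y)).
  rewrite /bis_inv_fun -!/(theta _) !thetaM theta_t inv_mapKV //.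
  by rewrite couMt.
split.
- by move=> a x y; rewrite /bis_inv_fun -!/(theta _) theta_linear linearP lq.
- by rewrite /bis_inv_fun -!/(theta _) theta1 cou1.
- move=> b X; rewrite /bis_inv_fun -!/(theta _) thetaM theta_t cou_t qM.
  by rewrite inv_mapK.
- by rewrite es; exact: inv_base_aut.
- exact: eM.
- move=> X Y; rewrite es.
  have -> : inv_map (inv_map phi) (bis_inv_fun H sigma Y) = eps (theta Y).
    by apply: (bij_inj bq); rewrite inv_mapKV.
  by rewrite /bis_inv_fun -!/(theta _) !thetaM theta_s couMs.
Qed.

Lemma bis_inv_mul X : bis_mul_fun H (bis_inv_fun H sigma) sigma X = eps X.
Proof.
have [lp [p1 pM] bp] := bis_aut sP.
have [lq [q1 qM] bq] := inv_base_aut.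
rewrite /bis_mul_fun /bis_inv_fun; apply: (bij_inj bp); rewrite -bis_theta.
rewrite (lin_tlift _ _ lp); apply: eq_tlift => x y.
by rewrite inv_mapKV // -/(theta _) theta_sl cou_s.
Qed.

End OneBisection.

Lemma cou_bisection : is_left_bisection H eps.
Proof.
have es : eps \o s = id by apply/funext => b; exact: cou_s1.
split.
- exact: linearP.
- exact: cou1.
- exact: (fun b X => cou_t b X).
- by rewrite es; split=> //; exists id.
- by move=> X Y; rewrite couMt.
- move=> X Y; rewrite es -couMs; congr (eps (_ * s _)).
  by rewrite -{1}[eps Y](inv_mapKV (f := id)) //; exists id.
Qed.

Lemma bis_mul_isP (sigma eta : L -> B) :
  is_left_bisection H sigma -> is_left_bisection H eta ->
  is_left_bisection H (bis_mul_fun H sigma eta).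
Proof.
move=> sP eP; have bm := bis_mul_balanced sP eP.
have em b : bis_mul_fun H sigma eta (s b) = sigma (s (eta (s b))).
  by rewrite /bis_mul_fun cop_src (tliftE bm) mulr1.
have ebase : bis_mul_fun H sigma eta \o s = (sigma \o s) \o (eta \o s).
  by apply/funext.
have aut : algebra_automorphism (bis_mul_fun H sigma eta \o s).
  rewrite ebase; have [ls [s1 sM] bs] := bis_aut sP; have [le [e1 eM] be] := bis_aut eP.
  split; last exact: bij_comp.
    by move=> a x y; rewrite [LHS]/= -[eta _]/((eta \o s) _) le -[LHS]/((sigma \o s) _) ls.
  split; first by rewrite [LHS]/= -[eta _]/((eta \o s) _) e1.
  by move=> x y; rewrite [LHS]/= -[eta _]/((eta \o s) _) eM -[LHS]/((sigma \o s) _) sM.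
have aMt X Y : bis_mul_fun H sigma eta (X * Y) =
    bis_mul_fun H sigma eta (X * t (bis_mul_fun H sigma eta Y)).
  rewrite /bis_mul_fun (copM_lift _ _ bm) (cop_tr _ _ bm) -/(bis_mul_fun H sigma eta Y).
  transitivity (\tsum_(Y1, Y2 <- D Y) \tsum_(X1, X2 <- D X)
      sigma (s (eta X1) * X2 * (s (eta Y1) * Y2))).
    apply: eq_tlift => y1 y2.
    transitivity (\tsum_(X1, X2 <- D X) sigma (s (eta (X1 * t (eta y1))) * (X2 * y2))).
      by apply: eq_tlift => x1 x2; rewrite -(bisMt eP).
    have bh : balB (fun x1 x2 => sigma (s (eta x1) * (x2 * y2))).
      split=> [w a x y|v a x y|b v w].
      - by rewrite (balanced_linl bm).
      - by rewrite mulrDl -scalerAl (balanced_linr bm).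
      - by rewrite -[s b * w * y2]mulrA (balanced_bal bm).
    rewrite (takeuchi_lift (eta y1) X bh).
    by apply: eq_tlift => x1 x2; rewrite !mulrA.
  pose F X1 X2 := fun z => sigma (s (eta X1) * X2 * z).
  have lF X1 X2 : linear (F X1 X2).
    by move=> a x y; rewrite /F mulrDr -scalerAr (bis_linear sP).
  rewrite /tlift exchange_big /=; apply: eq_bigr => -[x1 x2] _ /=.
  transitivity (sigma (s (eta x1) * x2 *
      (\tsum_(Y1, Y2 <- D Y) (s (eta Y1) * Y2)))).
    by rewrite -[RHS]/(F x1 x2 _) (lin_tlift _ _ (lF x1 x2)).
  rewrite (bisMt sP) (lin_tlift _ _ (bis_linear sP)).
  by rewrite mulrA.
split.
- by move=> a x y; rewrite /bis_mul_fun linearP (tlift_linear bm).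
- by rewrite /bis_mul_fun cop1 (tliftE bm) (bis1 eP) rmorph1 mulr1 (bis1 sP).
- move=> b X; rewrite /bis_mul_fun (cop_tl _ _ bm).
  rewrite [RHS](lin_tlift (u := fun z => z * b)).
    by apply: eq_tlift => x y; rewrite mulrA src_tgtC -mulrA (bis_t sP).
  by move=> a x y; rewrite mulrDl scalerAl.
- exact: aut.
- exact: aMt.
- move=> X Y; set c := inv_map _ _.
  have ec : bis_mul_fun H sigma eta (s c) = bis_mul_fun H sigma eta Y.
    by rewrite [LHS](inv_mapKV (f := bis_mul_fun H sigma eta \o s)) //; case: aut.
  by rewrite aMt -ec -aMt.
Qed.

Lemma bis_mulA_fun (sigma eta zeta : L -> B) :
    is_left_bisection H sigma -> is_left_bisection H eta ->
    is_left_bisection H zeta ->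
  bis_mul_fun H sigma (bis_mul_fun H eta zeta) =
  bis_mul_fun H (bis_mul_fun H sigma eta) zeta.
Proof.
move=> sP eP zP; apply/funext => X; have bse := bis_mul_balanced sP eP.
have bez := bis_mul_balanced eP zP.
pose h x y z := sigma (s (eta (s (zeta x) * y)) * z).
transitivity (\tsum_(X1, X2 <- D X) \tsum_(x, y <- D X1) h x y X2).
  apply: eq_tlift => x y; rewrite /bis_mul_fun (lin_tlift (u := fun z => sigma (s z * y))) //.
  by move=> a u v; rewrite linearP mulrDl -scalerAl (bis_linear sP).
rewrite cop_coassoc_lift.
- by apply: eq_tlift => x y; rewrite [RHS](cop_sl _ _ bse).
- move=> x; split=> [w a u v|v a u w|b v w]; rewrite /h.
  + by rewrite mulrDr -scalerAr (balanced_linl bse).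
  + by rewrite (balanced_linr bse).
  + by rewrite mulrA src_tgtC -mulrA (balanced_bal bse).
- move=> z; split=> [w a u v|v a u w|b v w]; rewrite /h.
  + by rewrite (balanced_linl bez) linearP mulrDl -scalerAl (bis_linear sP).
  + by rewrite (balanced_linr bez) linearP mulrDl -scalerAl (bis_linear sP).
  + by rewrite (balanced_bal bez).
Qed.

Lemma bis_mul1_fun (sigma : L -> B) :
  is_left_bisection H sigma -> bis_mul_fun H eps sigma = sigma.
Proof.
move=> sP; apply/funext => X; rewrite -[RHS](bis_cou_lift sP).
by apply: eq_tlift => x y; rewrite cou_s.
Qed.

Lemma bis_mul1r_fun (sigma : L -> B) :
  is_left_bisection H sigma -> bis_mul_fun H sigma eps = sigma.
Proof.
move=> sP; apply/funext => X; rewrite -[X in RHS](cou_copl H X).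
by rewrite (lin_tlift _ _ (bis_linear sP)).
Qed.

Lemma bis_inj (sigma eta : left_bisection H) :
  bis_fun sigma = bis_fun eta -> sigma = eta.
Proof.
case: sigma eta => [f fP] [g gP] /= e; case: _ / e gP => gP.
by congr LeftBisection; exact: Prop_irrelevance.
Qed.

Definition bis_one := LeftBisection cou_bisection.
Definition bis_mul (sigma eta : left_bisection H) :=
  LeftBisection (bis_mul_isP (bisP sigma) (bisP eta)).
Definition bis_inv (sigma : left_bisection H) :=
  LeftBisection (bis_inv_isP (bisP sigma)).

Lemma bis_mulA : associative bis_mul.
Proof. by move=> f g h; apply/bis_inj/bis_mulA_fun; exact: bisP. Qed.

Lemma bis_mul1 : left_id bis_one bis_mul.
Proof. by move=> f; apply/bis_inj/bis_mul1_fun/bisP. Qed.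

Lemma bis_mul1r : right_id bis_one bis_mul.
Proof. by move=> f; apply/bis_inj/bis_mul1r_fun/bisP. Qed.

Lemma bis_mulV : left_inverse bis_one bis_inv bis_mul.
Proof. by move=> f; apply/bis_inj/funext => X; exact: (bis_inv_mul (bisP f)). Qed.

Lemma bis_mulVr : right_inverse bis_one bis_inv bis_mul.
Proof.
move=> f; rewrite -[LHS]bis_mul1 -(bis_mulV (bis_inv f)) -bis_mulA.
by rewrite [bis_mul (bis_inv f) _]bis_mulA bis_mulV bis_mul1.
Qed.

Lemma aut_inj (F G : hopf_aut H) : autL F = autL G -> autB F = autB G -> F = G.
Proof.
case: F G => [f f' fP] [g g' gP] /= e; case: _ / e gP => gP e'.
by case: _ / e' gP => gP; congr HopfAut; exact: Prop_irrelevance.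
Qed.

Lemma algebra_automorphism_id (A : algType k) : algebra_automorphism (@idfun A).
Proof. by split=> //; exists id. Qed.

Lemma algebra_automorphism_comp (A : algType k) (f g : A -> A) :
  algebra_automorphism f -> algebra_automorphism g -> algebra_automorphism (f \o g).
Proof.
move=> [lf [f1 fM] bf] [lg [g1 gM] bg]; split; last exact: bij_comp.
  by move=> a x y /=; rewrite lg lf.
by split=> [|x y] /=; rewrite ?g1 ?f1 // gM fM.
Qed.

Lemma algebra_automorphism_inv (A : algType k) (f : A -> A) :
  algebra_automorphism f -> algebra_automorphism (inv_map f).
Proof.
move=> [lf [f1 fM] bf]; split; last exact: inv_map_bij.
  by move=> a x y; apply: (bij_inj bf); rewrite lf !inv_mapKV.
split=> [|x y]; apply: (bij_inj bf); first by rewrite f1 inv_mapKV.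
by rewrite fM !inv_mapKV.
Qed.

Lemma tmap_aut_balanced (Phi : L -> L) (phi : B -> B) : linear Phi ->
    {morph Phi : x y / x * y} -> (forall b, Phi (s b) = s (phi b)) ->
    (forall b, Phi (t b) = t (phi b)) ->
  balB (fun x y => tens (Phi x) (Phi y) : tensB s t).
Proof.
move=> lP PM Ps Pt; split=> [w a x y|v a x y|b v w].
- by rewrite lP tens_linl.
- by rewrite lP tens_linr.
- by rewrite !PM Ps Pt tens_bal.
Qed.

Lemma aut_one_isP : is_hopf_aut H idfun idfun.
Proof.
split=> //; try exact: algebra_automorphism_id.
by move=> X; rewrite -[RHS]tlift_tens.
Qed.

Lemma aut_mul_isP (F G : hopf_aut H) :
  is_hopf_aut H (autL F \o autL G) (autB F \o autB G).
Proof.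
case: F G => [f f' fP] [g g' gP] /=.
case: (fP) (gP) => af af' fs ft fD fe [ag ag' gs gt gD ge].
split; try exact: algebra_automorphism_comp.
- by move=> b /=; rewrite gs fs.
- by move=> b /=; rewrite gt ft.
- move=> X /=; rewrite -fD -gD [RHS]tlift_tmap //.
  by case: af => lf [_ fM] _; exact: (tmap_aut_balanced lf fM fs ft).
- by move=> X /=; rewrite fe ge.
Qed.

Lemma aut_inv_isP (F : hopf_aut H) :
  is_hopf_aut H (inv_map (autL F)) (inv_map (autB F)).
Proof.
case: F => [f f' fP] /=; case: (fP) => af af' fs ft fD fe.
have [_ _ bf] := af; have [_ _ bf'] := af'.
have [lg [_ gM] _] := algebra_automorphism_inv af.
have gs b : inv_map f (s b) = s (inv_map f' b).
  by apply: (bij_inj bf); rewrite fs !inv_mapKV.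
have gt b : inv_map f (t b) = t (inv_map f' b).
  by apply: (bij_inj bf); rewrite ft !inv_mapKV.
split=> //; try exact: algebra_automorphism_inv.
- move=> X; rewrite -{1}[X](inv_mapKV bf) -fD [LHS]tlift_tmap.
    rewrite -[RHS]tlift_tens; apply: eq_tlift => x y.
    by rewrite !inv_mapK.
  exact: (tmap_aut_balanced lg gM gs gt).
- by move=> X; apply: (bij_inj bf'); rewrite -fe !inv_mapKV.
Qed.

Definition aut_one := HopfAut aut_one_isP.
Definition aut_mul (F G : hopf_aut H) := HopfAut (aut_mul_isP F G).
Definition aut_inv (F : hopf_aut H) := HopfAut (aut_inv_isP F).

Lemma aut_mulA : associative aut_mul.
Proof. by move=> F G K; apply: aut_inj. Qed.

Lemma aut_mul1 : left_id aut_one aut_mul.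
Proof. by move=> F; apply: aut_inj. Qed.

Lemma aut_mul1r : right_id aut_one aut_mul.
Proof. by move=> F; apply: aut_inj. Qed.

Lemma aut_mulV : left_inverse aut_one aut_inv aut_mul.
Proof.
move=> F; have [[_ _ bf] [_ _ bf'] _ _ _ _] := autP F.
by apply: aut_inj; apply/funext => x; exact: inv_mapK.
Qed.

Lemma aut_mulVr : right_inverse aut_one aut_inv aut_mul.
Proof.
move=> F; have [[_ _ bf] [_ _ bf'] _ _ _ _] := autP F.
by apply: aut_inj; apply/funext => x; exact: inv_mapKV.
Qed.

HB.instance Definition _ := gen_eqMixin (left_bisection H).
HB.instance Definition _ := gen_choiceMixin (left_bisection H).
HB.instance Definition _ := isGroup.Build (left_bisection H)
  bis_mulA bis_mul1 bis_mul1r bis_mulV bis_mulVr.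

HB.instance Definition _ := gen_eqMixin (hopf_aut H).
HB.instance Definition _ := gen_choiceMixin (hopf_aut H).
HB.instance Definition _ := isGroup.Build (hopf_aut H)
  aut_mulA aut_mul1 aut_mul1r aut_mulV aut_mulVr.

End BisectionTheory.

End Theory.

(* Main.v *)
Require Import Defs.
From mathcomp Require Import all_boot all_order all_algebra.
From mathcomp Require Import boolp.

Set Implicit Arguments.
Unset Strict Implicit.
Unset Printing Implicit Defensive.

Import GRing.Theory.
Local Open Scope ring_scope.

(** A bisection [sigma] with base map [phi = sigma \o s] acts on the total
    algebra by two translations, as a bisection of a groupoid does:
    - [ltrans sigma X = s (sigma X_(1)) X_(2)],
    - [rtrans sigma X = t (phi^-1 (sigma X_(2))) X_(1)].
    The product of bisections can be read off either of them, since
    [(sigma * eta) X = sigma (ltrans eta X) = phi (eta (rtrans sigma X))].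
    Hence [ltrans] is multiplicative and [rtrans] antimultiplicative in
    [sigma] ([ltrans_mul], [rtrans_mul]), and both are bijective because the
    bisections form a group.

    The translation map X_+ (x) X_- enters through
    [theta : X |-> X_+ t (sigma X_-)].  From [(theta X)_(1) (x) (theta X)_(2) =
    X_(1) (x) theta (X_(2))] and [sigma (theta X) = phi (eps X)] it is a right
    inverse of [rtrans sigma], so it equals [rtrans sigma^-1] ([thetaE]).
    Consequently [Ad_sigma = theta \o ltrans sigma] is conjugation by [sigma]:
    left translation by [sigma] composed with right translation by its
    inverse, two operations that commute ([theta_ltrans]).

    This gives everything.  [Ad] is a group morphism because [ltrans] and
    [theta] are so and their values commute.  [Ad_sigma] is an algebra map
    because both factors are.  It respects the coproduct because [t (sigma X_(2)) Ad_sigma (X_(1)) =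
    ltrans sigma X] ([ltrans_Ad]), which lets the two inner copies of [sigma]
    in [Ad_sigma X_(1) (x) Ad_sigma X_(2)] cancel.  Equivariance holds since an
    automorphism intertwines the translations by [sigma] and by its image.
    For the Peiffer identity put [eta' = phi \o eta \o Ad_sigma^-1]; since
    [ltrans sigma = Ad_sigma \o rtrans sigma], the two formulas for the product
    give [(eta' * sigma) X = eta' (ltrans sigma X) = phi (eta (rtrans sigma X))
    = (sigma * eta) X]. *)

(** * Left and right translations by a bisection *)

Section Translations.
Variables (k : fieldType) (B L : algType k) (H : left_hopf_algebroid B L).
Local Notation s := (src H).
Local Notation t := (tgt H).
Local Notation D := (cop H).
Local Notation eps := (cou H).
Local Notation balB := (balanced (fun b X => t b * X) (fun b Y => s b * Y)).

Implicit Types (sigma eta : left_bisection H) (F G : hopf_aut H) (X Y : L).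

Definition ltrans sigma X : L := \tsum_(X1, X2 <- D X) (s (sigma X1) * X2).

Definition rtrans sigma X : L :=
  \tsum_(X1, X2 <- D X) (t (inv_map (sigma \o s) (sigma X2)) * X1).

Lemma mull_linear (a : L) : linear (fun x => a * x).
Proof. by move=> c x y; rewrite mulrDr -scalerAr. Qed.

Lemma mulr_linear (a : L) : linear (fun x => x * a).
Proof. by move=> c x y; rewrite mulrDl -scalerAl. Qed.

Lemma ltrans_balanced sigma : balB (fun x y => s (sigma x) * y).
Proof.
split=> [w a x y|v|b v w]; last by rewrite (bis_t (bisP sigma)) rmorphM mulrA.
  by rewrite (bis_linear (bisP sigma)) linearP mulrDl -scalerAl.
exact: mull_linear.
Qed.

Lemma rtrans_balanced sigma :
  balB (fun x y => t (inv_map (sigma \o s) (sigma y)) * x).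
Proof.
have [lq [_ qM] _] := inv_base_aut (bisP sigma).
split=> [w|v a x y|b v w]; first exact: mull_linear.
  by rewrite (bis_linear (bisP sigma)) lq linearP mulrDl -scalerAl.
rewrite (bis_sl (bisP sigma)) qM inv_mapK; last exact: base_bij (bisP sigma).
by rewrite tgtM mulrA.
Qed.

Lemma ltrans_linear sigma : linear (ltrans sigma).
Proof.
by move=> a x y; rewrite /ltrans linearP (tlift_linear (ltrans_balanced sigma)).
Qed.

(** Left translation only touches the first leg, by coassociativity: it is
    right colinear, as a left translation of a groupoid commutes with the right
    ones. *)
Lemma cop_ltrans (U : lmodType k) (h : L -> L -> U) sigma X : balB h ->
  tlift h (D (ltrans sigma X)) = \tsum_(X1, X2 <- D X) h (ltrans sigma X1) X2.
Proof.
move=> bh; have lD : linear (fun z => tlift h (D z)).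
  by move=> a x y; rewrite linearP (tlift_linear bh).
rewrite {1}/ltrans (lin_tlift _ _ lD).
under eq_tlift do rewrite (cop_sl _ _ bh).
rewrite -(cop_coassoc_lift (h := fun x y z => h (s (sigma x) * y) z)).
- by apply: eq_tlift => x z; rewrite (lin_tlift _ _ (balanced_linl bh z)).
- move=> x; split=> [w a u v|v|b v w].
  + by rewrite mulrDr -scalerAr (balanced_linl bh).
  + exact: balanced_linr bh _.
  + by rewrite mulrA src_tgtC -mulrA (balanced_bal bh).
- move=> z; have [bl br bb] := ltrans_balanced sigma.
  split=> [w a u v|v a u w|b v w].
  + by rewrite bl (balanced_linl bh).
  + by rewrite br (balanced_linl bh).
  + by rewrite bb.
Qed.

(** The mirror image of [cop_ltrans]: the second leg is translated. *)
Lemma cop_rtrans (U : lmodType k) (h : L -> L -> U) sigma X : balB h ->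
  tlift h (D (rtrans sigma X)) = \tsum_(X1, X2 <- D X) h X1 (rtrans sigma X2).
Proof.
move=> bh; have lD : linear (fun z => tlift h (D z)).
  by move=> a x y; rewrite linearP (tlift_linear bh).
rewrite {1}/rtrans (lin_tlift _ _ lD).
under eq_tlift do rewrite (cop_tl _ _ bh).
rewrite (cop_coassoc_lift (h := fun x y z =>
  h x (t (inv_map (sigma \o s) (sigma z)) * y))).
- by apply: eq_tlift => x z; rewrite (lin_tlift _ _ (balanced_linr bh x)).
- move=> x; have [bl br bb] := rtrans_balanced sigma.
  split=> [w a u v|v a u w|b v w].
  + by rewrite bl (balanced_linr bh).
  + by rewrite br (balanced_linr bh).
  + by rewrite bb.
- move=> z; split=> [w|v a u w|b v w].
  + exact: balanced_linl bh _.
  + by rewrite mulrDr -scalerAr (balanced_linr bh).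
  + by rewrite [t _ * (s b * w)]mulrA -src_tgtC -mulrA (balanced_bal bh).
Qed.

Lemma bis_mul_ltrans sigma eta X : (sigma * eta)%g X = sigma (ltrans eta X).
Proof. by rewrite /ltrans (lin_tlift _ _ (bis_linear (bisP sigma))). Qed.

Lemma ltrans1 X : ltrans 1%g X = X.
Proof. exact: cou_copl. Qed.

Lemma ltrans_mul sigma eta X :
  ltrans (sigma * eta)%g X = ltrans sigma (ltrans eta X).
Proof.
rewrite [RHS](cop_ltrans _ _ (ltrans_balanced sigma)).
by apply: eq_tlift => x y; rewrite bis_mul_ltrans.
Qed.

Lemma ltrans_bij sigma : bijective (ltrans sigma).
Proof.
by exists (ltrans sigma^-1%g) => X;
  rewrite -ltrans_mul ?mulVg ?mulgV ltrans1.
Qed.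

Lemma ltrans_s sigma b : ltrans sigma (s b) = s (sigma (s b)).
Proof. by rewrite /ltrans cop_src (tliftE (ltrans_balanced sigma)) mulr1. Qed.

Lemma ltrans_t sigma b : ltrans sigma (t b) = t b.
Proof.
by rewrite /ltrans cop_tgt (tliftE (ltrans_balanced sigma)) (bis1 (bisP sigma))
  rmorph1 mul1r.
Qed.

(** Property (3) of a bisection turns [sigma (X_(1) Y_(1))] into
    [sigma (X_(1) t (sigma Y_(1)))], and the Takeuchi condition moves
    [sigma Y_(1)] to the second leg as [s (sigma Y_(1))], exactly where the
    product of the two translations has it. *)
Lemma ltransM sigma X Y : ltrans sigma (X * Y) = ltrans sigma X * ltrans sigma Y.
Proof.
have bl := ltrans_balanced sigma.
rewrite {1}/ltrans (copM_lift _ _ bl).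
rewrite [in RHS]/ltrans [RHS](lin_tlift _ _ (mull_linear _)).
apply: eq_tlift => y1 y2.
rewrite [RHS](lin_tlift _ _ (mulr_linear _)).
transitivity (\tsum_(X1, X2 <- D X) (s (sigma (X1 * t (sigma y1))) * (X2 * y2))).
  by apply: eq_tlift => x1 x2; rewrite -(bisMt (bisP sigma)).
have bh : balB (fun x1 x2 => s (sigma x1) * (x2 * y2)).
  split=> [w|v a x y|b v w].
  - exact: balanced_linl bl _.
  - by rewrite mulrDl -scalerAl (balanced_linr bl).
  - by rewrite -[s b * w * y2]mulrA (balanced_bal bl).
rewrite (takeuchi_lift (sigma y1) X bh).
by apply: eq_tlift => x1 x2; rewrite !mulrA.
Qed.

(** Since [sigma (s b X) = phi b * sigma X], the product is
    [phi (eta X_(1)) * sigma X_(2)]; pulling [phi] out leaves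
    [eta X_(1) * phi^-1 (sigma X_(2))], which is [eta (rtrans sigma X)] because
    [eta (t b X) = eta X * b]. *)
Lemma bis_mul_rtrans sigma eta X :
  (sigma * eta)%g X = sigma (s (eta (rtrans sigma X))).
Proof.
have [lp [_ pM] bp] := bis_aut (bisP sigma).
have lh : linear (fun z => sigma (s (eta z))).
  by move=> a x y; rewrite (bis_linear (bisP eta)) -[LHS]/((sigma \o s) _) lp.
rewrite /rtrans (lin_tlift _ _ lh); apply: eq_tlift => x y.
rewrite (bis_t (bisP eta)) -[RHS]/((sigma \o s) _) pM inv_mapKV //.
by rewrite (bis_sl (bisP sigma)).
Qed.

Lemma rtrans1 X : rtrans 1%g X = X.
Proof.
rewrite -[RHS](cou_copr H X); apply: eq_tlift => x y.
congr (t _ * _); apply: (bij_inj (base_bij (bisP (1%g : left_bisection H)))).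
rewrite inv_mapKV; last exact: base_bij (bisP 1%g).
exact/esym/cou_s1.
Qed.

Lemma rtrans_mul sigma eta X :
  rtrans (sigma * eta)%g X = rtrans eta (rtrans sigma X).
Proof.
rewrite [RHS](cop_rtrans _ _ (rtrans_balanced eta)).
apply: eq_tlift => x y; congr (t _ * _).
(* Both sides are compared after applying the base map of [sigma * eta], which
   removes the inverse from the left; [bis_mul_rtrans] computes that base map
   as well as the value on [y]. *)
have bse := base_bij (bisP (sigma * eta)%g).
apply: (bij_inj bse); rewrite inv_mapKV //.
rewrite -[RHS]/((sigma * eta)%g (s _)) !bis_mul_rtrans; congr (sigma (s _)).
rewrite [rtrans sigma (s _)]/rtrans cop_src (tliftE (rtrans_balanced sigma)).
have [_ [q1 _] _] := inv_base_aut (bisP sigma).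
rewrite (bis1 (bisP sigma)) q1 tgt1 mul1r.
by rewrite -[RHS]/((eta \o s) _) inv_mapKV //; exact: base_bij (bisP eta).
Qed.

Lemma rtransK sigma : cancel (rtrans sigma) (rtrans sigma^-1%g).
Proof. by move=> X; rewrite -rtrans_mul mulgV rtrans1. Qed.

(** * The Hopf part is a right translation *)

(** A consequence of X_(1) (x) X_(2)+ (x) X_(2)- = X_+(1) (x) X_+(2) (x) X_-
    and of the fact that right multiplication by [t b] affects only the second
    leg of a coproduct. *)
Lemma cop_theta (U : lmodType k) (h : L -> L -> U) sigma X : balB h ->
  tlift h (D (theta H sigma X)) = \tsum_(X1, X2 <- D X) h X1 (theta H sigma X2).
Proof.
move=> bh; have lD : linear (fun z => tlift h (D z)).
  by move=> a x y; rewrite linearP (tlift_linear bh).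
rewrite {1}/theta (lin_tlift _ _ lD).
under eq_tlift do rewrite (cop_tr _ _ bh).
rewrite -(translation_cop (h := fun x p m => h x (p * t (sigma m)))).
- by apply: eq_tlift => x y; rewrite /theta (lin_tlift _ _ (balanced_linr bh x)).
- move=> x; have [bl br bb] := bis_Xp_Xm_balanced (bisP sigma).
  split=> [w a u v|v a u w|b v w].
  + by rewrite bl (balanced_linr bh).
  + by rewrite br (balanced_linr bh).
  + by rewrite bb.
- move=> z; split=> [w|v a u w|b v w].
  + exact: balanced_linl bh _.
  + by rewrite mulrDl -scalerAl (balanced_linr bh).
  + by rewrite -mulrA (balanced_bal bh).
Qed.

(** [sigma (X_+ t (sigma X_-)) = sigma (X_+ X_-)], and
    [X_+ X_- = s (eps X)]. *)
Lemma bis_of_theta sigma X : sigma (theta H sigma X) = sigma (s (eps X)).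
Proof.
rewrite -translation_cou /theta !(lin_tlift _ _ (bis_linear (bisP sigma))).
by apply: eq_tlift => p m; rewrite -(bisMt (bisP sigma)).
Qed.

Lemma rtrans_theta sigma X : rtrans sigma (theta H sigma X) = X.
Proof.
rewrite /rtrans (cop_theta _ _ (rtrans_balanced sigma)) -[RHS](cou_copr H X).
apply: eq_tlift => x y; rewrite bis_of_theta -[sigma (s _)]/((sigma \o s) _).
by rewrite inv_mapK //; exact: base_bij (bisP sigma).
Qed.

(** A right inverse of the bijection [rtrans sigma] is its inverse; this spares
    any further computation with X_+ and X_-. *)
Lemma thetaE sigma X : theta H sigma X = rtrans sigma^-1%g X.
Proof. by rewrite -[LHS](rtransK sigma) rtrans_theta. Qed.

Lemma theta_rtrans sigma X : theta H sigma (rtrans sigma X) = X.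
Proof. by rewrite thetaE rtransK. Qed.

Lemma theta_mul sigma eta X :
  theta H (sigma * eta)%g X = theta H sigma (theta H eta X).
Proof. by rewrite !thetaE invgM rtrans_mul. Qed.

Lemma theta_ltrans sigma eta X :
  theta H sigma (ltrans eta X) = ltrans eta (theta H sigma X).
Proof.
rewrite [RHS](cop_theta _ _ (ltrans_balanced eta)).
rewrite (lin_tlift _ _ (theta_linear (bisP sigma))).
by apply: eq_tlift => x y; rewrite (theta_sl (bisP sigma)).
Qed.

(** This is [theta (rtrans sigma X) = X] written out: [theta] maps
    [t (phi^-1 b)] to [t b]. *)
Lemma tgt_theta_cop sigma X :
  \tsum_(X1, X2 <- D X) (t (sigma X2) * theta H sigma X1) = X.
Proof.
rewrite -[RHS](theta_rtrans sigma) /rtrans.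
rewrite (lin_tlift _ _ (theta_linear (bisP sigma))).
apply: eq_tlift => x y; rewrite (thetaM (bisP sigma)) (theta_t (bisP sigma)).
by rewrite inv_mapKV //; exact: base_bij (bisP sigma).
Qed.

(** * The adjoint automorphism *)

Definition Ad_fun sigma X : L := theta H sigma (ltrans sigma X).

Lemma Ad_funE sigma X :
  Ad_fun sigma X = \tsum_(X1, X2 <- D X) (s (sigma X1) * theta H sigma X2).
Proof.
by rewrite /Ad_fun theta_ltrans /ltrans (cop_theta _ _ (ltrans_balanced sigma)).
Qed.

Lemma tgt_theta_balanced sigma :
  balB (fun x y => t (sigma y) * theta H sigma x).
Proof.
split=> [w a x y|v a x y|b v w].
- by rewrite (theta_linear (bisP sigma)) mull_linear.
- by rewrite (bis_linear (bisP sigma)) linearP mulr_linear.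
- by rewrite (thetaM (bisP sigma)) (theta_t (bisP sigma)) (bis_sl (bisP sigma))
    tgtM mulrA.
Qed.

(** Conjugating by [sigma] and then multiplying by [sigma] on the right is
    multiplying by [sigma] on the left. *)
Lemma ltrans_Ad sigma X :
  ltrans sigma X = \tsum_(X1, X2 <- D X) (t (sigma X2) * Ad_fun sigma X1).
Proof.
rewrite -[LHS](tgt_theta_cop sigma).
exact: (cop_ltrans _ _ (tgt_theta_balanced sigma)).
Qed.

Lemma Ad_linear sigma : linear (Ad_fun sigma).
Proof.
by move=> a x y; rewrite /Ad_fun ltrans_linear (theta_linear (bisP sigma)).
Qed.

Lemma AdM sigma X Y : Ad_fun sigma (X * Y) = Ad_fun sigma X * Ad_fun sigma Y.
Proof. by rewrite /Ad_fun ltransM (thetaM (bisP sigma)). Qed.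

Lemma Ad_s sigma b : Ad_fun sigma (s b) = s (sigma (s b)).
Proof. by rewrite /Ad_fun ltrans_s (theta_s (bisP sigma)). Qed.

Lemma Ad_t sigma b : Ad_fun sigma (t b) = t (sigma (s b)).
Proof. by rewrite /Ad_fun ltrans_t (theta_t (bisP sigma)). Qed.

Lemma Ad_algebra_automorphism sigma : algebra_automorphism (Ad_fun sigma).
Proof.
split; [exact: Ad_linear | split; last exact: AdM |].
- by have := Ad_s sigma 1; rewrite !rmorph1 (bis1 (bisP sigma)) rmorph1.
- apply: bij_comp (ltrans_bij sigma); exists (rtrans sigma).
    exact: rtrans_theta.
  exact: theta_rtrans.
Qed.

(** In [s (sigma X_(1)) theta (X_(2)) (x) s (sigma X_(3)) theta (X_(4))] the
    factor [s (sigma X_(3))] crosses the tensor sign as [t (sigma X_(3))], where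
    [ltrans_Ad] absorbs it; what remains is
    [ltrans sigma X_(1) (x) theta X_(2)], the coproduct of [Ad_fun sigma X] by
    [cop_theta] and [cop_ltrans]. *)
Lemma Ad_cop sigma X :
  tmap (Ad_fun sigma) (Ad_fun sigma) (D X) = D (Ad_fun sigma X).
Proof.
have bt := tensB_tens H.
have bth : balB (fun x y => tens x (theta H sigma y) : tensB s t).
  split=> [w|v a x y|b v w]; first exact: balanced_linl bt _.
    by rewrite (theta_linear (bisP sigma)) (balanced_linr bt).
  by rewrite (theta_sl (bisP sigma)) (balanced_bal bt).
rewrite -[RHS]tlift_tens (cop_theta _ _ bt) (cop_ltrans _ _ bth).
transitivity (\tsum_(X1, X2 <- D X) \tsum_(x, y <- D X2)
    (tens (t (sigma x) * Ad_fun sigma X1) (theta H sigma y) : tensB s t)).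
  apply: eq_tlift => x y; rewrite [Ad_fun sigma y]Ad_funE.
  rewrite (lin_tlift _ _ (balanced_linr bt _)).
  by apply: eq_tlift => y1 y2; rewrite tens_bal.
rewrite -(cop_coassoc_lift (h := fun x y z =>
  tens (t (sigma y) * Ad_fun sigma x) (theta H sigma z) : tensB s t)).
- apply: eq_tlift => x z; rewrite ltrans_Ad.
  by rewrite (lin_tlift _ _ (balanced_linl bt _)).
- move=> x; split=> [w a u v|v|b v w].
  + by rewrite (bis_linear (bisP sigma)) linearP mulr_linear (balanced_linl bth).
  + exact: balanced_linr bth _.
  + by rewrite (bis_t (bisP sigma)) tgtM -mulrA (balanced_bal bth).
- move=> z; split=> [w a u v|v a u w|b v w].
  + by rewrite Ad_linear mull_linear (balanced_linl bth).
  + by rewrite (bis_linear (bisP sigma)) linearP mulr_linear (balanced_linl bth).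
  + by rewrite AdM Ad_t (bis_sl (bisP sigma)) tgtM mulrA.
Qed.

Lemma Ad_isP sigma : is_hopf_aut H (Ad_fun sigma) (sigma \o s).
Proof.
split.
- exact: Ad_algebra_automorphism.
- exact: bis_aut (bisP sigma).
- by move=> b; exact: Ad_s.
- by move=> b; exact: Ad_t.
- exact: Ad_cop.
- move=> X; rewrite Ad_funE -(bis_theta (bisP sigma)).
  rewrite (lin_tlift (u := eps)); last exact: linearP.
  by apply: eq_tlift => x y; rewrite cou_s.
Qed.

Definition Ad sigma : hopf_aut H := HopfAut (Ad_isP sigma).

Lemma Ad_morph : {morph Ad : sigma eta / (sigma * eta)%g}.
Proof.
move=> sigma eta; apply: aut_inj; apply/funext => x /=.
  by rewrite /Ad_fun ltrans_mul theta_mul -theta_ltrans.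
by apply: etrans (bis_mul_ltrans sigma eta (s x)) _; rewrite ltrans_s.
Qed.

(** * The action of automorphisms on bisections *)

(** Every element is a value of [autL F], so that the inverse in [act_fun]
    never has to be handled: it suffices to evaluate at [autL F X]. *)
Lemma aut_ind F (P : L -> Prop) :
  (forall X, P (autL F X)) -> forall X, P X.
Proof.
have [[_ _ bF] _ _ _ _ _] := autP F.
by move=> h X; rewrite -[X](inv_mapKV bF).
Qed.

Definition act_fun F (sigma : L -> B) X : B :=
  autB F (sigma (inv_map (autL F) X)).

Lemma act_fun_autL F sigma X : act_fun F sigma (autL F X) = autB F (sigma X).
Proof.
have [[_ _ bF] _ _ _ _ _] := autP F.
by rewrite /act_fun inv_mapK.
Qed.

Lemma act_fun_base F sigma b :
  act_fun F sigma (s (autB F b)) = autB F (sigma (s b)).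
Proof. by have [_ _ <- _ _ _] := autP F; rewrite act_fun_autL. Qed.

Lemma act_isP F sigma : is_left_bisection H (act_fun F sigma).
Proof.
have [[lF [F1 FM] bF] [lf [f1 fM] bf] Fs Ft _ _] := autP F.
have sP := bisP sigma.
have [lG [G1 GM] bG] := algebra_automorphism_inv (aut_total (autP F)).
have aut : algebra_automorphism (act_fun F sigma \o s).
  have -> : act_fun F sigma \o s =
      autB F \o ((sigma \o s) \o inv_map (autB F)).
    by apply/funext => b /=; rewrite -{1}[b](inv_mapKV bf) act_fun_base.
  apply: algebra_automorphism_comp => //; apply: algebra_automorphism_comp.
    exact: bis_aut sP.
  exact: algebra_automorphism_inv.
have eMt X Y : act_fun F sigma (X * Y) =
    act_fun F sigma (X * t (act_fun F sigma Y)).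
  elim/(aut_ind (F := F)): X => X; elim/(aut_ind (F := F)): Y => Y.
  by rewrite act_fun_autL -Ft -!FM !act_fun_autL -(bisMt sP).
split.
- by move=> a x y; rewrite /act_fun lG (bis_linear sP) lf.
- by rewrite -[in LHS]F1 act_fun_autL (bis1 sP).
- move=> b; elim/(aut_ind (F := F)) => X; rewrite -[b in t b](inv_mapKV bf) -Ft -FM.
  by rewrite !act_fun_autL (bis_t sP) fM inv_mapKV.
- exact: aut.
- exact: eMt.
- move=> X Y; have [_ _ ba] := aut.
  rewrite eMt [RHS]eMt; congr (act_fun F sigma (X * t _)).
  by rewrite -[RHS]/((act_fun F sigma \o s) _) inv_mapKV.
Qed.

Definition act F sigma : left_bisection H := LeftBisection (act_isP F sigma).

Lemma act_autL F sigma X : act F sigma (autL F X) = autB F (sigma X).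
Proof. exact: act_fun_autL. Qed.

Lemma act_base F sigma b : act F sigma (s (autB F b)) = autB F (sigma (s b)).
Proof. exact: act_fun_base. Qed.

Lemma aut_cop_lift (U : lmodType k) (h : L -> L -> U) F X : balB h ->
  tlift h (D (autL F X)) = \tsum_(X1, X2 <- D X) h (autL F X1) (autL F X2).
Proof. by move=> bh; have [_ _ _ _ <- _] := autP F; rewrite tlift_tmap. Qed.

Lemma act_ltrans F sigma X :
  ltrans (act F sigma) (autL F X) = autL F (ltrans sigma X).
Proof.
have [[lF [_ FM] _] _ Fs _ _ _] := autP F.
rewrite {1}/ltrans (aut_cop_lift _ _ (ltrans_balanced _)).
rewrite /ltrans (lin_tlift _ _ lF); apply: eq_tlift => x y.
by rewrite FM Fs act_autL.
Qed.

Lemma act_rtrans F sigma X :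
  rtrans (act F sigma) (autL F X) = autL F (rtrans sigma X).
Proof.
have [[lF [_ FM] _] _ _ Ft _ _] := autP F.
rewrite {1}/rtrans (aut_cop_lift _ _ (rtrans_balanced _)).
rewrite /rtrans (lin_tlift _ _ lF); apply: eq_tlift => x y.
rewrite FM Ft; congr (t _ * _).
apply: (bij_inj (base_bij (bisP (act F sigma)))).
rewrite inv_mapKV; last exact: base_bij (bisP (act F sigma)).
rewrite -[RHS]/(act F sigma (s _)) act_autL act_base.
rewrite -[sigma (s _)]/((sigma \o s) _).
by rewrite inv_mapKV //; exact: base_bij (bisP sigma).
Qed.

Lemma act_theta F sigma X :
  theta H (act F sigma) (autL F X) = autL F (theta H sigma X).
Proof. by rewrite -[X in LHS](rtrans_theta sigma) -act_rtrans theta_rtrans. Qed.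

Lemma bis_eqP sigma eta : sigma =1 eta -> sigma = eta.
Proof. by move=> e; apply/bis_inj/funext. Qed.

Lemma act_morph F : {morph act F : sigma eta / (sigma * eta)%g}.
Proof.
move=> sigma eta; apply: bis_eqP; elim/(aut_ind (F := F)) => X.
by rewrite bis_mul_ltrans act_ltrans !act_autL bis_mul_ltrans.
Qed.

Lemma act1 sigma : act 1%g sigma = sigma.
Proof. by apply: bis_eqP => X; exact: (act_autL 1%g). Qed.

Lemma actM F G sigma : act (F * G)%g sigma = act F (act G sigma).
Proof.
apply: bis_eqP; elim/(aut_ind (F := (F * G)%g)) => X.
by rewrite [LHS]act_autL [RHS](act_autL F (act G sigma)) act_autL.
Qed.

(** * The crossed module identities *)

Lemma Ad_act F sigma : Ad (act F sigma) = (F * Ad sigma * F^-1)%g.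
Proof.
apply: (mulIg F); rewrite mulgVK; apply: aut_inj; apply/funext => x /=.
  by rewrite /Ad_fun act_ltrans act_theta.
exact: act_base.
Qed.

(** Multiplied by [sigma] on the right, both sides become the base map of
    [sigma] applied to [eta (rtrans sigma X)]: on the left because the product
    is evaluated through [ltrans sigma = Ad_sigma \o rtrans sigma], on the right
    by [bis_mul_rtrans]. *)
Lemma act_Ad sigma eta : act (Ad sigma) eta = (sigma * eta * sigma^-1)%g.
Proof.
apply: (mulIg sigma); rewrite mulgVK; apply: bis_eqP => X.
rewrite [LHS]bis_mul_ltrans [RHS]bis_mul_rtrans.
have -> : ltrans sigma X = Ad_fun sigma (rtrans sigma X).
  by rewrite /Ad_fun theta_ltrans theta_rtrans.
exact: (act_autL (Ad sigma)).
Qed.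

End Translations.

Theorem proposition3p5 (k : fieldType) (B L : algType k)
    (H : left_hopf_algebroid B L) :
  exists (Ad : left_bisection H -> hopf_aut H)
         (act : hopf_aut H -> left_bisection H -> left_bisection H),
    [/\ forall (sigma : left_bisection H) (X : L),
          autL (Ad sigma) X =
          \tsum_(X1, X2 <- cop H X)
            (src H (sigma X1) *
             \tsum_(X2p, X2m <- translation H X2) (X2p * tgt H (sigma X2m))),
        forall (sigma : left_bisection H) (b : B),
          autB (Ad sigma) b = sigma (src H b),
        forall (F : hopf_aut H) (sigma : left_bisection H) (X : L),
          act F sigma X = autB F (sigma (inv_map (autL F) X))
      & crossed_module Ad act].
Proof.
exists (@Ad k B L H), (@act k B L H); split=> //; first exact: Ad_funE.
split.
- exact: Ad_morph.
- exact: act1.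
- exact: actM.
- exact: act_morph.
- exact: Ad_act.
- exact: act_Ad.
Qed.
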